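(* Let $\mathcal{C}$ be a decomposition of the edge set of a nontrivial eulerian graph $G$ into circuits. (a) If $G$ is a tree of cycles and $\mathcal{C}$ is the collection of cycles of $G$, then every embedding of $G$ relative to $\mathcal{C}$ is planar and has exactly one outer face, and at least one such embedding exists. (b) Otherwise, $G$ has both an orientable and a nonorientable embedding relative to $\mathcal{C}$, and there is at least one embedding of $G$ relative to $\mathcal{C}$ that is nonorientable and has exactly one outer face. Moreover, for every embedding of $G$ relative to $\mathcal{C}$ with exactly one outer face, the outer face is bounded by an euler circuit, and the embedding has maximum Euler genus (and hence maximum orientable or nonorientable genus, as appropriate) over all embeddings of $G$ relative to $\mathcal{C}$.
   Context: Graphs are finite and may have loops and multiple edges; nontrivial means having at least one edge. A graph is eulerian if it has a circuit (closed trail) using every edge and vertex (an euler circuit). A tree of cycles is a connected graph all of whose blocks are cycles. Embeddings are cellular in closed surfaces. Given a collection $\mathcal{W}$ of closed walks in a connected graph $G$, an embedding of $G$ relative to $\mathcal{W}$ is an embedding whose multiset of facial walks is $\mathcal{W}\cup\mathcal{W}'$ for some collection $\mathcal{W}'$ of closed walks; faces bounded by elements of $\mathcal{W}$ are inner faces and those bounded by elements of $\mathcal{W}'$ are outer faces. The Euler genus of a surface is its genus if nonorientable and twice its genus if orientable. *)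

(* Defs.v *)
From HB Require Import structures.
From mathcomp Require Import all_boot all_order perm all_algebra.

Set Implicit Arguments.
Unset Strict Implicit.
Unset Printing Implicit Defensive.

Import GRing.Theory Num.Theory.

(** * Graphs with loops and multiple edges *)

(** The two ends of an edge are indexed by [bool]; a loop has equal ends. *)
Record multigraph := Multigraph {
  vertex : finType;
  edge : finType;
  ends : edge -> bool -> vertex
}.

(** A dart [(e, b)] is a half-edge, or equivalently the edge [e] traversed from
    its end [b] to its end [~~ b].  The two traversals of a loop are distinct
    darts, as facial walks require. *)
Definition dart (G : multigraph) : finType := (edge G * bool)%type.

Definition dtail (G : multigraph) (d : dart G) : vertex G := ends d.1 d.2.
Definition dhead (G : multigraph) (d : dart G) : vertex G := ends d.1 (~~ d.2).
Definition dflip (G : multigraph) (d : dart G) : dart G := (d.1, ~~ d.2).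

Definition nontrivial (G : multigraph) : Prop := exists e : edge G, true.

(** * Walks *)

Definition walk (G : multigraph) : Type := seq (dart G).

(** Closed walks have length at least one. *)
Definition closed_walk (G : multigraph) (w : walk G) : bool :=
  (w != [::]) && cycle [rel d1 d2 | dhead d1 == dtail d2] w.

Definition walk_edges (G : multigraph) (w : walk G) : seq (edge G) :=
  [seq d.1 | d <- w].

Definition circuit (G : multigraph) (w : walk G) : bool :=
  closed_walk w && uniq (walk_edges w).

Definition is_cycle (G : multigraph) (w : walk G) : bool :=
  circuit w && uniq [seq dtail d | d <- w].

Definition euler_circuit (G : multigraph) (w : walk G) : Prop :=
  [/\ circuit w,
      forall e : edge G, e \in walk_edges w
    & forall v : vertex G, v \in [seq dtail d | d <- w]].

Definition eulerian (G : multigraph) : Prop :=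
  exists w : walk G, euler_circuit w.

Definition rev_walk (G : multigraph) (w : walk G) : walk G :=
  rev [seq dflip d | d <- w].

(** Closed walks are considered up to the choice of a starting point and of a
    direction of traversal. *)
Definition same_walk (G : multigraph) (w1 w2 : walk G) : bool :=
  [exists n : 'I_(size w2).+1,
    (w1 == rot n w2) || (w1 == rot n (rev_walk w2))].

(** Equality of multisets of closed walks, up to [same_walk]. *)
Definition same_walks (G : multigraph) (W1 W2 : seq (walk G)) : Prop :=
  exists2 W : seq (walk G), perm_eq W W1 & all2 (@same_walk G) W W2.

(** Every edge of [G] is used exactly once by exactly one element of [C]. *)
Definition circuit_decomposition (G : multigraph) (C : seq (walk G)) : Prop :=
  all (@circuit G) C /\
  perm_eq (flatten [seq walk_edges w | w <- C]) (enum (edge G)).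

Definition collection_of_all_cycles (G : multigraph) (C : seq (walk G)) :
    Prop :=
  forall w : walk G, is_cycle w <-> exists2 w', w' \in C & same_walk w w'.

(** * Blocks and trees of cycles *)

(** A subgraph without isolated vertices is given by its set of edges. *)

Definition edge_set_vertices (G : multigraph) (S : {set edge G}) :
    {set vertex G} :=
  [set v | [exists e in S, [exists b, ends e b == v]]].

Definition adjacent_in (G : multigraph) (S : {set edge G}) : rel (vertex G) :=
  [rel u v | [exists e in S, [exists b, (ends e b == u) && (ends e (~~ b) == v)]]].

Definition connected_edge_set (G : multigraph) (S : {set edge G}) : Prop :=
  forall u v, u \in edge_set_vertices S -> v \in edge_set_vertices S ->
    connect (adjacent_in S) u v.

Definition connected_graph (G : multigraph) : Prop :=
  (exists v : vertex G, true) /\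
  forall u v : vertex G, connect (adjacent_in [set: edge G]) u v.

(** A decomposition into two nontrivial connected subgraphs that have exactly
    one vertex in common; deleting a vertex would not do as a definition, since
    a loop must be separated from the other edges at its vertex. *)
Definition separation (G : multigraph) (S S1 S2 : {set edge G}) : Prop :=
  [/\ S1 :|: S2 = S, [disjoint S1 & S2], (S1 != set0) && (S2 != set0),
      connected_edge_set S1 /\ connected_edge_set S2
    & #|edge_set_vertices S1 :&: edge_set_vertices S2| = 1].

Definition nonseparable (G : multigraph) (S : {set edge G}) : Prop :=
  [/\ S != set0, connected_edge_set S
    & forall S1 S2 : {set edge G}, ~ separation S S1 S2].

(** A block of a connected graph with at least one edge has an edge itself, so
    it is a maximal nonseparable set of edges. *)
Definition block (G : multigraph) (S : {set edge G}) : Prop :=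
  nonseparable S /\
  forall S' : {set edge G}, S \subset S' -> nonseparable S' -> S' = S.

Definition tree_of_cycles (G : multigraph) : Prop :=
  connected_graph G /\
  forall S : {set edge G}, block S ->
    exists2 w : walk G, is_cycle w & S = [set e | e \in walk_edges w].

(** * Cellular embeddings in closed surfaces *)

(** A cellular embedding of a connected graph with at least one edge is encoded
    by a rotation system, that is a cyclic permutation of the half-edges at
    each vertex, and a signature, [twisted e] meaning that the local
    orientations at the two ends of [e] disagree along [e]. *)
Record embedding (G : multigraph) := Embedding {
  rotation : {perm dart G};
  twisted : edge G -> bool;
  rotation_at_vertex : forall d : dart G,
    porbit rotation d = [set d' | dtail d' == dtail d]
}.

(** Face tracing.  In a state [(d, s)] the dart [d] is about to be traversed,
    and [s] tells whether the tracing currently disagrees with the local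
    orientation.  [face_step] traverses [d] and turns to the next dart of the
    face; [face_reverse] is the state that traverses the same side of the same
    edge in the opposite direction. *)
Definition face_state (G : multigraph) : finType := (dart G * bool)%type.

Definition face_step (G : multigraph) (M : embedding G) (x : face_state G) :
    face_state G :=
  let s := x.2 (+) twisted M x.1.1 in
  let d := dflip x.1 in
  (if s then (rotation M)^-1%g d else rotation M d, s).

Definition face_reverse (G : multigraph) (M : embedding G) (x : face_state G) :
    face_state G :=
  (dflip x.1, ~~ (x.2 (+) twisted M x.1.1)).

Definition facial_walk (G : multigraph) (M : embedding G) (x : face_state G) :
    walk G :=
  [seq y.1 | y <- orbit (face_step M) x].

Definition same_face (G : multigraph) (M : embedding G) : rel (face_state G) :=
  [rel x y | (y == face_step M x) || (y == face_reverse M x)].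

(** One walk for each face. *)
Definition facial_walks (G : multigraph) (M : embedding G) : seq (walk G) :=
  [seq facial_walk M x | x <- enum (roots (same_face M))].

(** [W] bounds the inner faces and [W'] bounds the outer faces. *)
Definition relative_embedding (G : multigraph) (M : embedding G)
    (W W' : seq (walk G)) : Prop :=
  all (@closed_walk G) W' /\ same_walks (facial_walks M) (W ++ W').

(** * The surface of an embedding *)

(** The local orientations at the vertices can be chosen coherently: reversing
    them where [o] is true untwists every edge. *)
Definition orientable (G : multigraph) (M : embedding G) : bool :=
  [exists o : {ffun vertex G -> bool},
    [forall e, twisted M e == o (ends e false) (+) o (ends e true)]].

Definition euler_characteristic (G : multigraph) (M : embedding G) : int :=
  (#|vertex G|%:Z - #|edge G|%:Z + (size (facial_walks M))%:Z)%R.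

(** The sphere with [h] handles has Euler characteristic [2 - 2 h], and the
    sphere with [k] crosscaps has Euler characteristic [2 - k]. *)
Definition genus (G : multigraph) (M : embedding G) : int :=
  if orientable M then ((2 - euler_characteristic M)%R %/ 2)%Z
  else (2 - euler_characteristic M)%R.

Definition euler_genus (G : multigraph) (M : embedding G) : int :=
  (if orientable M then 2 * genus M else genus M)%R.

Definition planar (G : multigraph) (M : embedding G) : Prop :=
  orientable M /\ genus M = 0%R.

(* Main.v *)
Require Import Defs.
From HB Require Import structures.
From mathcomp Require Import fingroup all_boot all_order perm all_algebra zify.

Set Implicit Arguments.
Unset Strict Implicit.
Unset Printing Implicit Defensive.

Import GroupScope.

(** Half-edges are darts, and the circuits of [C] pair the half-edges between
    which they turn.  An embedding relative to [C] amounts to a second pairing of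
    the half-edges at each vertex, by the outer corners, such that the two
    pairings [P] and [Q] together form one cycle per vertex; with the flip of the
    edges, [P] traces the inner faces and [Q] the outer ones, and the embedding is
    orientable if and only if the three involutions admit a common 2-colouring.

    Conjugating [Q] by the transposition of [h] and [P h] keeps the vertices.  If
    [h] and [P h] lie on different outer faces, this merges these faces; hence one
    outer face can always be reached.  If there is one outer face and the
    embedding is orientable, this keeps a single outer face, and the result is
    nonorientable unless the pass [{h, P h}] is a bridge of the bipartite
    incidence graph of circuits and vertices.  So (b) holds unless this graph is a
    tree, which means that [G] is a tree of cycles and [C] its set of cycles.  In
    that case every relative embedding is orientable, so that the parity of the
    number of outer faces is fixed and merging is impossible: there is one outer
    face.  The maximality statement follows since an edge is on one inner and one
    outer side, hence there is always an outer face. *)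

(** * Pairs of fixed-point-free involutions *)

(** The corners pair up because [C] uses each edge once: exactly one of the two sides of a half-edge
    is inner, so inner and outer corners alternate around a vertex. Conditions on cycles are stated
    as counts. On a class of two fixed-point-free involutions their product has exactly two orbits,
    one per direction, so having one cycle per vertex means [2 * #|V|] orbits and having one outer
    face means 2 orbits. Such counts survive conjugation and change by a known amount under a
    transposition, so no face has to be traced through a modification. Bridges appear as follows: if
    an embedding stays orientable under the conjugation, the old and the new 2-colouring differ by a
    function of the circuit and, up to the transposition, by a function of the vertex. These two
    functions disagree exactly on [{h, P h}], which is thus a cut with a single edge. Conversely, in
    a tree every set of passes is a cut; this converts the colouring of half-edges at the vertices
    into a common one, and it also gives the count [#|V| + size C = #|E| + 1] behind planarity. *)

Definition fpf_involution (T : finType) (a : {perm T}) : Prop :=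
  forall x, a (a x) = x /\ a x != x.

Definition pair_connect (T : finType) (a b : {perm T}) : rel T :=
  connect [rel x y | (y == a x) || (y == b x)].

Lemma porbit_invariant (T : finType) (A : Type) (s : {perm T}) (f : T -> A) :
  (forall x, f (s x) = f x) -> forall x y, y \in porbit s x -> f y = f x.
Proof.
move=> fs x y /porbitP[i ->]; elim: i => [|i IHi]; first by rewrite expg0 perm1.
by rewrite expgSr permM fs.
Qed.

Lemma card_porbitsJ (T : finType) (s t : {perm T}) :
  #|porbits (t^-1 * (s * t))| = #|porbits s|.
Proof.
suff -> : porbits (t^-1 * (s * t)) = (fun A : {set T} => t @: A) @: porbits s.
  by rewrite card_imset //; apply: imset_inj; apply: perm_inj.
have orbJ x : porbit (t^-1 * (s * t)) (t x) = t @: porbit s x.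
  apply/setP => y; apply/idP/imsetP => [/porbitP[i ->]|[z /porbitP[i ->] ->]].
    exists ((s ^+ i) x); first exact: mem_porbit.
    by rewrite -conjgE -conjXg conjgE !permM permK.
  apply/porbitP; exists i.
  by rewrite -conjgE -conjXg conjgE !permM permK.
apply/setP => A; apply/imsetP/imsetP => [[x _ ->]|[B /imsetP[x _ ->] ->]].
  exists (porbit s (t^-1 x)); first exact: imset_f.
  by rewrite -orbJ permKV.
by exists (t x); rewrite ?orbJ.
Qed.

Section PairOfInvolutions.
Variables (T : finType) (a b : {perm T}).
Hypotheses (ai : fpf_involution a) (bi : fpf_involution b).
Let s := a * b.

Let aK x : a (a x) = x. Proof. by case: (ai x). Qed.
Let bK x : b (b x) = x. Proof. by case: (bi x). Qed.
Let sE x : s x = b (a x). Proof. exact: permM. Qed.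

(* The orbit of [x] is reversed by [a]; the middle of an orbit meeting its image
   would be a fixed point of [a] or of [b]. *)
Lemma fpf_notin_porbit x : a x \notin porbit s x.
Proof.
suff H i : forall x, a x != (s ^+ i) x.
  by apply/negP => /porbitP[i ax]; case/eqP: (H i x).
elim/ltn_ind: i => -[|[|i]] IHi {}x.
- by rewrite expg0 perm1; case: (ai x).
- by rewrite expg1 permM eq_sym; case: (bi (a x)).
apply: contraNneq (IHi i (leqnSn _) (s x)) => ax.
apply/eqP/(@perm_inj _ s); have -> : s ((s ^+ i) (s x)) = (s ^+ i.+2) x.
  by rewrite !permX -iterSr.
by rewrite -ax !sE aK bK.
Qed.

(** Conjugation by [a] inverts [a * b], so [a] carries orbits to orbits. *)
Lemma mem_porbit_fpf x y : y \in porbit s x -> a y \in porbit s (a x).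
Proof.
move=> /porbitP[i ->]; elim: i => [|i IHi].
  by rewrite expg0 perm1 porbit_id.
rewrite -eq_porbit_mem in IHi; rewrite -(eqP IHi) porbit_sym; apply/porbitP.
by exists 1%N; rewrite expg1 expgSr !permM aK bK.
Qed.

(** The group generated by [a] and [b] is dihedral with rotations generated by [a * b]; a class is a
    rotation orbit together with its image under [a]. *)
Lemma pair_connectE x y :
  pair_connect a b x y = (y \in porbit s x) || (y \in porbit s (a x)).
Proof.
have sub z w : w \in porbit s z -> pair_connect a b z w.
  move=> /porbitP[i ->]; elim: i => [|i IHi]; first by rewrite expg0 perm1; exact: connect0.
  apply: connect_trans IHi _; rewrite expgSr permM sE.
  by apply: (connect_trans (y := a ((s ^+ i) z))); apply: connect1; rewrite /= eqxx ?orbT.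
apply/idP/orP=> [/connectP[p]|[/sub //|/sub]]; last first.
  by apply: connect_trans; apply: connect1; rewrite /= eqxx.
elim: p x => [|z p IHp] x /=; first by move=> _ ->; left; exact: porbit_id.
case/andP=> /orP[]/eqP-> zp /(IHp _ zp); rewrite ?aK; first by case; auto.
have porbs z' : porbit s (s z') = porbit s z'.
  by rewrite -(porbit_perm s 1 z') expg1.
have -> : porbit s (b x) = porbit s (a x) by rewrite -{1}(aK x) -sE porbs.
have -> : porbit s (a (b x)) = porbit s x by rewrite -porbs sE aK bK.
by case; auto.
Qed.

Lemma pair_connect_sym : symmetric (pair_connect a b).
Proof.
apply: sym_connect_sym => x y /=.
by apply/orP/orP=> -[]/eqP->; rewrite ?aK ?bK eqxx; auto.
Qed.

Section Fibers.
Variables (V : finType) (f : T -> V).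
Hypotheses (fa : forall x, f (a x) = f x) (fb : forall x, f (b x) = f x).
Hypothesis f_surj : forall v, exists x, f x == v.

Let r v := xchoose (f_surj v).
Let fr v : f (r v) = v. Proof. exact/eqP/(xchooseP (f_surj v)). Qed.
Let fs x : f (s x) = f x. Proof. by rewrite permM fb fa. Qed.
(** Every value of [f] supplies two disjoint orbits, so there are at least [2 * #|V|] of them.
    Equality in this bound is what characterizes connected fibres. *)
Let rep (i : V * bool) := porbit s (if i.2 then r i.1 else a (r i.1)).

Let rep_inj : injective rep.
Proof.
move=> [v i] [w j] /eqP; rewrite /rep eq_porbit_mem /= => vw.
have := porbit_invariant fs vw; have -> : f (if i then r v else a (r v)) = v.
  by case: i {vw}; rewrite ?fa.
have -> : f (if j then r w else a (r w)) = w by case: j {vw}; rewrite ?fa.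
move=> Evw; move: vw; rewrite Evw.
case: i j => -[] //; last by rewrite (negbTE (fpf_notin_porbit _)).
by rewrite porbit_sym (negbTE (fpf_notin_porbit _)).
Qed.

Let sub_rep : rep @: setT \subset porbits s.
Proof. by apply/subsetP => A /imsetP[i _ ->]; exact: imset_f. Qed.

Let card_rep : #|rep @: setT| = #|V|.*2.
Proof. by rewrite card_imset // cardsT card_prod card_bool muln2. Qed.

Lemma fibers_card :
  (forall x y, f x = f y -> pair_connect a b x y) -> #|porbits s| = #|V|.*2.
Proof.
move=> conn; rewrite -card_rep; congr #|pred_of_set _|; apply/eqP.
rewrite eqEsubset sub_rep andbT; apply/subsetP => A /imsetP[x _ ->].
have := conn (r (f x)) x (fr _); rewrite pair_connectE.
case/orP; rewrite -eq_porbit_mem => /eqP->; apply/imsetP.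
  by exists (f x, true).
by exists (f x, false).
Qed.

Lemma fibers_connected :
  #|porbits s| = #|V|.*2 -> forall x y, f x = f y -> pair_connect a b x y.
Proof.
move=> cardE; have repE : rep @: setT = porbits s.
  by apply/eqP; rewrite eqEcard sub_rep card_rep cardE leqnn.
suff H x : pair_connect a b (r (f x)) x.
  move=> x y fxy; apply: (connect_trans (y := r (f x))); last by rewrite fxy; exact: H.
  by rewrite -[connect _]/(pair_connect a b) pair_connect_sym.
have : porbit s x \in rep @: setT by rewrite repE imset_f.
case/imsetP=> -[v i] _ /eqP; rewrite /rep eq_porbit_mem /= => xv.
have := porbit_invariant fs xv; have -> : f (if i then r v else a (r v)) = v.
  by case: i {xv}; rewrite ?fa.
by move=> ->; rewrite pair_connectE; case: i xv => ->; rewrite ?orbT.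
Qed.

(* Each fibre is a union of exactly two orbits. *)
Lemma fibers_bicoloring : #|porbits s| = #|V|.*2 ->
  exists eps : T -> bool, forall x, eps (a x) = ~~ eps x /\ eps (b x) = ~~ eps x.
Proof.
(* [eps] marks one of the two orbits in each fibre; [a] exchanges them and [a * b] keeps them, so
   [b] exchanges them too. *)
move=> cardE; pose eps x := x \in porbit s (r (f x)).
have epsa x : eps (a x) = ~~ eps x.
  have := fibers_connected cardE (fr (f x)); rewrite pair_connectE /eps fa.
  case: (boolP (x \in porbit s _)) => /= xr H.
    apply: contraTF (mem_porbit_fpf xr) => axr; rewrite porbit_sym.
    apply/negP => axr'; have := fpf_notin_porbit (r (f x)); rewrite porbit_sym.
    by move: axr axr'; rewrite -!eq_porbit_mem => /eqP-> /eqP->; rewrite eqxx.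
  by move/mem_porbit_fpf: H; rewrite aK.
have epss z : eps (s z) = eps z.
  by rewrite /eps fs -!eq_porbit_mem -(porbit_perm s 1 z) expg1.
by exists eps => x; split=> //; rewrite -epsa -[in LHS](aK x) -sE epss.
Qed.

End Fibers.

End PairOfInvolutions.

Lemma card_porbitsC (T : finType) (a b : {perm T}) :
  #|porbits (a * b)| = #|porbits (b * a)|.
Proof. by rewrite -(card_porbitsJ (a * b) a) !mulgA mulVg mul1g. Qed.

Lemma fpf_involutionJ (T : finType) (a t : {perm T}) :
  fpf_involution a -> fpf_involution (a ^ t).
Proof.
move=> ai x; rewrite -(permKV t x) !permJ; case: (ai (t^-1 x)) => -> ax.
by rewrite (inj_eq perm_inj).
Qed.

(** Up to conjugacy, the change of [b] multiplies [c * b] by two transpositions, and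
    [porbits_mul_tperm] applies to each of them. *)
Lemma card_porbits_swap (T : finType) (c b : {perm T}) (y z : T) :
  fpf_involution c ->
  #|porbits (c * b ^ tperm y z)| =
  #|porbits (tperm y z * (tperm (c y) (c z) * (c * b)))|.
Proof.
move=> ci; have cV : c^-1 = c.
  by apply/eqP; rewrite eq_invg_mul; apply/eqP/permP => x; rewrite permM perm1; case: (ci x).
rewrite -(card_porbitsJ (tperm y z * _) (tperm y z)) -tpermJ !conjgE cV tpermV.
by rewrite !mulgA tperm2 mul1g -[c * _ * c * c]mulgA -[X in X * c]cV mulVg mulg1.
Qed.

(* Exchanging the partners of [y] and [z] in [b] joins the orbits of [y] and
   [z], in both directions of traversal. *)
Lemma merge_orbits (T : finType) (c b : {perm T}) (y z : T) :
  fpf_involution c -> fpf_involution b -> ~~ pair_connect c b y z ->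
  (#|porbits (c * b ^ tperm y z)|).+2 = #|porbits (c * b)|.
Proof.
move=> ci bi nyz; rewrite card_porbits_swap //.
have cK x : c (c x) = x by case: (ci x).
have memc x w : (c x \in porbit (c * b) w) -> x \in porbit (c * b) (c w).
  by move/(mem_porbit_fpf ci bi); rewrite cK.
have nyz1 : y \notin porbit (c * b) z.
  by apply: contra nyz => yz; rewrite pair_connectE // porbit_sym yz.
have nyz2 : z \notin porbit (c * b) (c y).
  by apply: contra nyz => zy; rewrite pair_connectE // zy orbT.
have nyz3 : c z \notin porbit (c * b) y.
  by apply: contra nyz2; apply: memc.
have nyz4 : c y \notin porbit (c * b) (c z).
  by apply: contra nyz1 => /memc; rewrite cK.
have yz : y != z by apply: contraNneq nyz1 => ->; exact: porbit_id.
have := porbits_mul_tperm (c * b) (c y) (c z).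
rewrite /= nyz4 (inj_eq perm_inj) yz => E1.
have := porbits_mul_tperm (tperm (c y) (c z) * (c * b)) y z.
(* The transposition of [c y] and [c z] acts off the orbit of [y], so this orbit is unchanged and
   still misses [z]. *)
rewrite /= yz; suff -> : y \notin porbit (tperm (c y) (c z) * (c * b)) z by lia.
rewrite porbit_sym; apply/negP => /porbitP[i zE]; case/negP: nyz1.
rewrite porbit_sym {}zE; elim: i => [|i IHi]; first by rewrite expg0 perm1 porbit_id.
rewrite expgSr permM; set w := fun_of_perm (_ ^+ i) y in IHi *; rewrite permM tpermD.
- by rewrite -eq_porbit_mem -(porbit_perm _ 1 w) expg1 eq_porbit_mem in IHi.
- by apply: contraTneq IHi => <-; exact: fpf_notin_porbit.
- by apply: contraTneq IHi => <-.
Qed.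

(** The two orbits are the colour classes, and they separate [y] from [z] and [c y] from [c z]. The
    transposition of [c y] and [c z] joins them, and that of [y] and [z] splits the single orbit
    again. *)
Lemma twist_orbits (T : finType) (c b : {perm T}) (o : T -> bool) (y z : T) :
  fpf_involution c -> (forall x, o (c x) = ~~ o x) ->
  (forall x, o (b x) = ~~ o x) -> o y != o z ->
  #|porbits (c * b)| = 2 -> #|porbits (c * b ^ tperm y z)| = 2.
Proof.
move=> ci oc ob oyz N2; rewrite card_porbits_swap //.
have os x : o ((c * b) x) = o x by rewrite permM ob oc negbK.
have yz : y != z by apply: contraNneq oyz => ->.
have := porbits_mul_tperm (c * b) (c y) (c z).
have -> : c y \notin porbit (c * b) (c z).
  by apply: contra oyz => /(porbit_invariant os); rewrite !oc => /negb_inj ->.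
rewrite /= (inj_eq perm_inj) yz N2 => E1.
have /eqP/cards1P[A porbE] : #|porbits (tperm (c y) (c z) * (c * b))| = 1%N.
  by apply: (@addIn 2); rewrite -[2 in LHS]/(nat_of_bool true).*2 E1.
have := porbits_mul_tperm (tperm (c y) (c z) * (c * b)) y z.
rewrite /= yz porbE cards1 -eq_porbit_mem.
have in_A x : porbit (tperm (c y) (c z) * (c * b)) x = A.
  by apply/set1P; rewrite -porbE imset_f.
by rewrite !in_A eqxx /=; lia.
Qed.

(** * Parity of orbit counts for 2-coloured involutions *)

Section Bicoloring.
Variables (T : finType) (o : T -> bool).

Definition bichromatic (a : {perm T}) := forall x, o (a x) = ~~ o x.

Section Alternate.
Variables a b : {perm T}.
Hypotheses (oa : bichromatic a) (ob : bichromatic b).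

Let alt_inj : injective (fun x => if o x then a x else b x).
Proof.
move=> x y; case ox: (o x); case oy: (o y) => E; try exact: (perm_inj E);
by have := congr1 o E; rewrite ?oa ?ob ox oy.
Qed.

(** Runs through each class of [a] and [b] in one direction only: the class is one orbit here, while
    it is two orbits of [a * b]. *)
Definition alternate : {perm T} := perm alt_inj.

Lemma alternateE x : alternate x = if o x then a x else b x.
Proof. exact: permE. Qed.

End Alternate.

Lemma card_porbits_alternate (a b : {perm T}) (oa : bichromatic a)
    (ob : bichromatic b) : fpf_involution a -> fpf_involution b ->
  #|porbits (a * b)| = #|porbits (alternate oa ob)|.*2.
Proof.
move=> ai bi; set q := alternate oa ob.
have aK x : a (a x) = x by case: (ai x).
have bK x : b (b x) = x by case: (bi x).
have qP x : porbit q x \in porbits q by exact: imset_f.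
pose f x : {A | A \in porbits q} := Sub (porbit q x) (qP x).
have porbq x : porbit q (q x) = porbit q x by rewrite -(porbit_perm q 1 x) expg1.
have fP x y : porbit q x = porbit q y -> f x = f y by move=> E; apply: val_inj.
rewrite (@fibers_card _ a b ai bi _ f); first by rewrite card_sig.
- move=> x; apply: fP; case ox: (o x).
    by rewrite -[RHS]porbq [q x]alternateE ox.
  by rewrite -[LHS]porbq [q _]alternateE oa ox aK.
- move=> x; apply: fP; case ox: (o x).
    by rewrite -[LHS]porbq [q _]alternateE ob ox bK.
  by rewrite -[RHS]porbq [q x]alternateE ox.
- by case=> A /[dup] /imsetP[x _ E] qA; exists x; apply/eqP/val_inj; rewrite /= E.
move=> x y /(congr1 val) /= /eqP; rewrite eq_sym eq_porbit_mem => /porbitP[i ->].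
elim: i => [|i IHi]; first by rewrite expg0 perm1; exact: connect0.
apply: connect_trans IHi _; apply: connect1; rewrite expgSr permM alternateE /=.
by case: (o _); rewrite eqxx ?orbT.
Qed.

(* Restricted to one colour class, [a * b], [b * c] and [c * a] have product 1. *)
Lemma parity_bicoloring (a b c : {perm T}) :
  fpf_involution a -> fpf_involution b -> fpf_involution c ->
  bichromatic a -> bichromatic b -> bichromatic c ->
  odd #|porbits (a * b)|./2 (+) odd #|porbits (b * c)|./2
    (+) odd #|porbits (c * a)|./2 =
  a (+) b (+) c (+) odd #|T|.
Proof.
move=> ai bi ci oa ob oc.
rewrite (card_porbits_alternate oa ob) // (card_porbits_alternate ob oc) //.
rewrite (card_porbits_alternate oc oa) // !doubleK.
(* With the trailing [c], [b], [a] the three factors preserve colours: they are the identity on the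
   colour [true], and [a * c], [c * b], [b * a] on the colour [false], where the product
   telescopes. *)
have /(congr1 (@odd_perm T)) :
    alternate oc oa * c * (alternate ob oc * b) * (alternate oa ob * a) = 1.
  apply/permP => x; rewrite !permM perm1 !alternateE.
  have aK w : a (a w) = w by case: (ai w).
  have bK w : b (b w) = w by case: (bi w).
  have cK w : c (c w) = w by case: (ci w).
  case ox: (o x); first by rewrite cK ox bK ox aK.
  by rewrite oc oa ox /= cK ob oa ox /= bK aK.
rewrite !odd_permM odd_perm1 /odd_perm.
move: (odd #|porbits (alternate _ _)|) (odd #|porbits (alternate oa ob)|)
  (odd #|porbits (alternate ob oc)|) (odd #|porbits a|) (odd #|porbits b|)
  (odd #|porbits c|) (odd #|T|).
by do 7! case.
Qed.

End Bicoloring.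

(** * Darts and circuit decompositions *)

Lemma uniq_map_inj_in (T U : eqType) (f : T -> U) (s : seq T) :
  uniq (map f s) -> {in s &, injective f}.
Proof.
elim: s => //= z s IHs /andP[fz_s Us] x y; rewrite !inE.
case/predU1P=> [->|xs] /predU1P[->|ys] // E; last exact: IHs.
  by rewrite E map_f in fz_s.
by rewrite -E map_f in fz_s.
Qed.

Lemma uniq_flatten_nth (T : eqType) (ss : seq (seq T)) (x : T) (i j : nat) :
  uniq (flatten ss) -> x \in nth [::] ss i -> x \in nth [::] ss j -> i = j.
Proof.
have mem_fl (rr : seq (seq T)) k : x \in nth [::] rr k -> x \in flatten rr.
  move=> xk; apply/flattenP; exists (nth [::] rr k) => //.
  by rewrite mem_nth //; case: ltnP xk => // ?; rewrite nth_default.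
elim: ss i j => [|s ss IHs] [|i] [|j] //=; rewrite cat_uniq => /and3P[_ /hasPn D Us].
- by move=> xs /mem_fl/D; rewrite /= xs.
- by move=> /mem_fl/D /= /negP xs /xs.
- by move=> xi xj; rewrite (IHs i j).
Qed.

Section Darts.
Variable G : multigraph.
Implicit Types (d h : dart G) (w : walk G).

Lemma dflipK : involutive (@dflip G).
Proof. by case=> e b; rewrite /dflip /= negbK. Qed.

Lemma dflip_neq d : dflip d != d.
Proof. by case: d => e b; rewrite xpair_eqE eqxx /=; case: b. Qed.

Lemma dart_same_edge d d' : d.1 = d'.1 -> d' = d \/ d' = dflip d.
Proof.
case: d d' => e b [e' b'] /= ->; case: b b' => -[]; rewrite /dflip /=; auto.
Qed.

Lemma dtail_dflip d : dtail (dflip d) = dhead d.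
Proof. by []. Qed.

Lemma dhead_dflip d : dhead (dflip d) = dtail d.
Proof. by rewrite -dtail_dflip dflipK. Qed.

Definition edge_flip : {perm dart G} := perm (inv_inj dflipK).

Lemma edge_flipE d : edge_flip d = dflip d.
Proof. exact: permE. Qed.

Lemma edge_flip_fpf : fpf_involution edge_flip.
Proof. by move=> d; rewrite !edge_flipE dflipK dflip_neq. Qed.

(** A walk arriving along [d] reaches the half-edge [dflip d] and leaves by the partner of the
    latter. *)
Definition follows (P : {perm dart G}) : pred (walk G) :=
  cycle [rel d d' | P (dflip d) == d'].

Lemma follows_next (P : {perm dart G}) w d : follows P w -> d \in w -> P (dflip d) = next w d.
Proof. by move=> Pw dw; apply/eqP; exact: (next_cycle Pw dw). Qed.

Lemma follows_rev (P : {perm dart G}) w : involutive P -> follows P (rev_walk w) = follows P w.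
Proof.
move=> PK; rewrite /follows rev_cycle cycle_map; apply: eq_cycle => d d' /=.
by rewrite dflipK eq_sym -(inj_eq (@perm_inj _ P)) PK eq_sym.
Qed.

Lemma closed_walk_next w d : closed_walk w -> d \in w -> dhead d = dtail (next w d).
Proof. by case/andP=> _ cw dw; apply/eqP; exact: (next_cycle cw dw). Qed.

Lemma circuit_uniq w : circuit w -> uniq w.
Proof. by case/andP=> _; exact: map_uniq. Qed.

Lemma circuit_mem_dflip w d : circuit w -> d \in w -> dflip d \notin w.
Proof.
case/andP=> _ Uw dw; apply/negP => fdw.
by have := uniq_map_inj_in Uw fdw dw erefl; apply/eqP; exact: dflip_neq.
Qed.

Lemma mem_walk_edges w (d : dart G) :
  (d.1 \in walk_edges w) = (d \in w) || (dflip d \in w).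
Proof.
apply/mapP/orP => [[d' d'w /dart_same_edge[]E]|[dw|dw]].
- by left; rewrite -E.
- by right; rewrite -E.
- by exists d.
- by exists (dflip d).
Qed.

(** The form in which connectedness is used: consecutive darts of an euler circuit are related by a
    flip and a common tail, and the circuit meets every edge. *)
Lemma eulerian_invariant (A : Type) (K : dart G -> A) : eulerian G ->
    (forall d, K (dflip d) = K d) ->
    (forall d d', dtail d = dtail d' -> K d = K d') ->
  forall d d', K d = K d'.
Proof.
case=> w [/andP[/andP[_ cw] _] we _] Kf Kv.
have Kw d d' : d \in w -> d' \in w -> K d = K d'.
  have Kn x : x \in w -> K (next w x) = K x.
    move=> xw; rewrite -[RHS]Kf; apply: Kv; apply/esym/eqP.
    exact: (next_cycle cw xw).
  suff {d d'} H x p : path [rel d1 d2 | dhead d1 == dtail d2] x p ->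
      {in p, forall y, K y = K x}.
    case: w cw {we Kn} => // x p cw dw d'w.
    have {}H z : z \in x :: p -> K z = K x.
      by move=> zp; apply: (H x (rcons p x)); rewrite // mem_rcons.
    by rewrite (H d) // (H d').
  elim: p x => //= z p IHp x /andP[/eqP xz zp].
  have Kzx : K z = K x by rewrite -(Kf x); apply: Kv.
  by move=> y; rewrite inE => /predU1P[-> //|yp]; rewrite (IHp z).
have Kin d : exists2 d', d' \in w & K d = K d'.
  have := we d.1; rewrite mem_walk_edges => /orP[] dw; first by exists d.
  by exists (dflip d); rewrite ?Kf.
move=> d d'; have [[x xw ->] [y yw ->]] := (Kin d, Kin d').
exact: Kw.
Qed.

Lemma eulerian_dtail : eulerian G -> forall v, exists d, dtail d == v.
Proof.
by case=> w [_ _ wv] v; have /mapP[d _ ->] := wv v; exists d.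
Qed.

End Darts.

(** * The pairing of half-edges defined by the circuits *)

Section Decomposition.
Variables (G : multigraph) (C : seq (walk G)).
Hypothesis decC : circuit_decomposition C.
Implicit Types (d h : dart G) (w : walk G) (e : edge G).

Lemma decomposition_circuit w : w \in C -> circuit w.
Proof. by case: decC => /allP H _; apply: H. Qed.

Let idx e := find (fun w => e \in walk_edges w) C.

Let has_idx e : has (fun w => e \in walk_edges w) C.
Proof.
case: decC => _ /perm_mem/(_ e); rewrite mem_enum => /flattenP[s /mapP[w wC ->]] ew.
by apply/hasP; exists w.
Qed.

Let idx_lt e : idx e < size C. Proof. by rewrite -has_find. Qed.

(** Circuits are represented by positions in [C], so that they form exactly [size C] nodes of the
    incidence graph. *)
Definition circuit_index e : 'I_(size C) := Ordinal (idx_lt e).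

Definition circuit_of e : walk G := nth [::] C (circuit_index e).

Lemma circuit_of_mem e : circuit_of e \in C.
Proof. exact: mem_nth. Qed.

Lemma circuit_ofP e : e \in walk_edges (circuit_of e).
Proof. exact: (nth_find [::] (has_idx e)). Qed.

Lemma circuit_index_nth e i : e \in walk_edges (nth [::] C i) -> i = circuit_index e.
Proof.
move=> ei; apply: (@uniq_flatten_nth _ [seq walk_edges w | w <- C] e).
- by case: decC => _ /perm_uniq ->; exact: enum_uniq.
- case: (ltnP i (size C)) ei => iC; first by rewrite (nth_map [::]).
  by rewrite nth_default.
- by rewrite (nth_map [::]) //; exact: circuit_ofP.
Qed.

Lemma circuit_of_unique w e : w \in C -> e \in walk_edges w -> w = circuit_of e.
Proof.
move=> /(nthP [::])[i iC <-] ei; congr (nth _ _ _).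
exact: circuit_index_nth.
Qed.

Lemma circuit_index_mem w e e' : w \in C -> e \in walk_edges w ->
  e' \in walk_edges w -> circuit_index e = circuit_index e'.
Proof.
move=> /(nthP [::])[i iC <-] ei e'i; apply: val_inj.
exact: etrans (esym (circuit_index_nth ei)) (circuit_index_nth e'i).
Qed.

(** These are the half-edges by which the circuits leave a vertex; they form a 2-colouring for the
    edge flip and for the inner pairing. *)
Definition forward h := h \in circuit_of h.1.

Lemma forward_dflip h : forward (dflip h) = ~~ forward h.
Proof.
have cw := decomposition_circuit (circuit_of_mem h.1).
have := circuit_ofP h.1; rewrite mem_walk_edges /forward [(dflip h).1]/=.
case: (boolP (h \in _)) => [hw _|_ /= -> //].
by rewrite (negbTE (circuit_mem_dflip cw hw)).
Qed.

Lemma mem_circuit_of w d : w \in C -> d \in w -> circuit_of d.1 = w.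
Proof.
by move=> wC dw; rewrite -(circuit_of_unique wC) // mem_walk_edges dw.
Qed.

Lemma mem_forward w d : w \in C -> d \in w -> forward d.
Proof. by move=> wC dw; rewrite /forward (mem_circuit_of wC dw). Qed.

Lemma mem_circuit_index w d d' : w \in C -> d \in w -> d' \in w ->
  circuit_index d.1 = circuit_index d'.1.
Proof.
by move=> wC dw d'w; apply: (circuit_index_mem wC); rewrite mem_walk_edges ?dw ?d'w.
Qed.

Definition inner_pairing (P : {perm dart G}) : Prop :=
  [/\ fpf_involution P, forall h, dtail (P h) = dtail h
    & forall w, w \in C -> follows P w].

Lemma exists_inner_pairing : exists P, inner_pairing P.
Proof.
(* A pass leaves by a forward [h], and the partner is where it entered; otherwise the pass enters by
   [h], and the partner is where it leaves. *)
pose f h := if forward h then dflip (prev (circuit_of h.1) h)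
            else next (circuit_of h.1) (dflip h).
have Uw e : uniq (circuit_of e) by exact/circuit_uniq/decomposition_circuit/circuit_of_mem.
have nfw h : ~~ forward h -> dflip h \in circuit_of h.1.
  by rewrite -forward_dflip.
have fK : involutive f.
  move=> h; rewrite {2}/f; case: ifPn => [hw|/nfw hw].
    have pw : prev (circuit_of h.1) h \in circuit_of h.1 by rewrite mem_prev.
    rewrite /f forward_dflip (mem_forward (circuit_of_mem _) pw) /= dflipK.
    by rewrite (mem_circuit_of (circuit_of_mem _) pw) next_prev.
  have nw : next (circuit_of h.1) (dflip h) \in circuit_of h.1 by rewrite mem_next.
  rewrite /f (mem_forward (circuit_of_mem _) nw).
  by rewrite (mem_circuit_of (circuit_of_mem _) nw) prev_next // dflipK.
have ftail h : dtail (f h) = dtail h.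
  have cw e : closed_walk (circuit_of e).
    by have /andP[] := decomposition_circuit (circuit_of_mem e).
  rewrite /f; case: ifPn => [hw|/nfw hw].
    rewrite dtail_dflip (closed_walk_next (cw h.1)) ?mem_prev //.
    by rewrite next_prev.
  by rewrite -(closed_walk_next (cw h.1)) // dhead_dflip.
have ffw h : forward (f h) = ~~ forward h.
  rewrite /f; case: ifPn => [hw|/nfw hw].
    by rewrite forward_dflip (mem_forward (circuit_of_mem h.1)) // mem_prev.
  by rewrite (mem_forward (circuit_of_mem h.1)) // mem_next.
exists (perm (inv_inj fK)); split.
- move=> h; rewrite !permE; split; first exact: fK.
  by apply/eqP => /(congr1 forward); rewrite ffw; case: forward.
- by move=> h; rewrite permE ftail.
move=> w wC; rewrite /follows.
have wU : uniq w by exact/circuit_uniq/decomposition_circuit.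
apply: (sub_in_cycle (P := mem w) _ _ (cycle_next wU)); last exact/allP.
move=> d d' dw _ /eqP <-; apply/eqP.
by rewrite /= permE /f forward_dflip (mem_forward wC dw) dflipK (mem_circuit_of wC dw).
Qed.

Section Pairing.
Variable P : {perm dart G}.
Hypothesis innerP : inner_pairing P.

Lemma inner_pairing_next w d : w \in C -> d \in w -> P (dflip d) = next w d.
Proof. by case: innerP => _ _ H wC; apply: follows_next; apply: H. Qed.

Lemma inner_pairing_prev w d : w \in C -> d \in w -> P d = dflip (prev w d).
Proof.
move=> wC dw; have wU : uniq w by exact/circuit_uniq/decomposition_circuit.
have {1}<- : P (dflip (prev w d)) = d.
  by rewrite (inner_pairing_next wC) ?mem_prev // next_prev.
by case: innerP => Pi _ _; case: (Pi (dflip (prev w d))).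
Qed.

Lemma inner_pairing_cases (h : dart G) :
    (exists d, [/\ d \in circuit_of h.1, h = dflip d & P h = next (circuit_of h.1) d])
  \/ h \in circuit_of h.1 /\ P h = dflip (prev (circuit_of h.1) h).
Proof.
have wC := circuit_of_mem h.1.
case: (boolP (forward h)) => hw; first by right; rewrite (inner_pairing_prev wC).
left; exists (dflip h); rewrite -(inner_pairing_next wC) ?dflipK.
  by rewrite -forward_dflip in hw.
by rewrite -forward_dflip in hw.
Qed.

Lemma forward_inner h : forward (P h) = ~~ forward h.
Proof.
have wC := circuit_of_mem h.1; case: (inner_pairing_cases h) => [[d [dw E ->]]|[hw ->]].
  rewrite (mem_forward wC) ?mem_next //.
  by rewrite [h in ~~ forward h]E forward_dflip (mem_forward wC dw).
by rewrite forward_dflip !(mem_forward wC) // mem_prev.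
Qed.

Lemma circuit_index_inner h : circuit_index (P h).1 = circuit_index h.1.
Proof.
have wC := circuit_of_mem h.1; case: (inner_pairing_cases h) => [[d [dw E ->]]|[hw ->]].
  by rewrite (mem_circuit_index (d' := d) wC) ?mem_next // E.
by rewrite (mem_circuit_index (d := prev _ h) (d' := h) wC) // mem_prev.
Qed.

(** The passes of the circuits exhaust the half-edges. This will identify the pairing read off the
    inner corners of a given embedding with [P]. *)
Lemma inner_pairing_unique (Q : dart G -> dart G) : involutive Q ->
    (forall w, w \in C -> cycle [rel d d' | Q (dflip d) == d'] w) ->
  P =1 Q.
Proof.
move=> QK Qw h; have wC := circuit_of_mem h.1.
case: (inner_pairing_cases h) => [[d [dw E ->]]|[hw ->]].
  by rewrite [in RHS]E; have /eqP-> := next_cycle (Qw _ wC) dw.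
have Uw : uniq (circuit_of h.1) by exact/circuit_uniq/decomposition_circuit.
have := next_cycle (Qw _ wC) (x := prev (circuit_of h.1) h).
by rewrite mem_prev next_prev // => /(_ hw) /= /eqP E; rewrite -[in RHS]E QK.
Qed.

End Pairing.

End Decomposition.

(** * Outer pairings *)

Section Pairings.
Variables (G : multigraph) (C : seq (walk G)) (P : {perm dart G}).
Hypotheses (eulG : eulerian G) (decC : circuit_decomposition C).
Hypothesis innerP : inner_pairing C P.
Implicit Types (h k : dart G) (Q : {perm dart G}).

Local Notation phi := (edge_flip G).
Local Notation cidx := (circuit_index decC).

Let Pfpf : fpf_involution P. Proof. by case: innerP. Qed.
Let PK : involutive P. Proof. by move=> h; case: (Pfpf h). Qed.
Let Ptail h : dtail (P h) = dtail h. Proof. by case: innerP. Qed.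

(** The circuits are the classes of the edge flip and [P]. *)
Lemma inner_pairing_invariant (A : Type) (f : dart G -> A) :
    (forall h, f (dflip h) = f h) -> (forall h, f (P h) = f h) ->
  forall h k, cidx h.1 = cidx k.1 -> f h = f k.
Proof.
move=> ff fP; have fw w d d' : w \in C -> d \in w -> d' \in w -> f d = f d'.
  case: innerP => _ _ /(_ w) follw wC dw d'w.
  have /connectP[p] := connect_cycle (follw wC) dw d'w.
  elim: p d {dw d'w} => [|x p IHp] d /=; first by move=> _ ->.
  by case/andP=> /eqP Ex xp /(IHp _ xp) <-; rewrite -Ex fP ff.
have rep h : exists2 d, d \in circuit_of decC h.1 & f h = f d.
  have := circuit_ofP decC h.1; rewrite mem_walk_edges.
  by case/orP=> hw; [exists h | exists (dflip h)].
move=> h k E; have [[d dw ->] [d' d'w ->]] := (rep h, rep k).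
by apply: fw dw _; rewrite ?circuit_of_mem // /circuit_of E.
Qed.

Lemma exists_circuit_dart (i : 'I_(size C)) : exists h, cidx h.1 == i.
Proof.
have wC : nth [::] C i \in C by exact: mem_nth.
case E: (nth [::] C i) (decomposition_circuit decC wC) => [|d w] // _.
exists d; apply/eqP/val_inj/esym; apply: (circuit_index_nth decC).
by rewrite E /= inE eqxx.
Qed.

(** The count expresses that [P] and [Q] together are transitive on the half-edges at each vertex;
    in this form the condition passes to conjugates. *)
Definition outer_pairing Q : Prop :=
  [/\ fpf_involution Q, forall h, dtail (Q h) = dtail h
    & #|porbits (P * Q)| = #|vertex G|.*2].

Lemma outer_pairing_connected Q : outer_pairing Q ->
  forall h k, dtail h = dtail k -> pair_connect P Q h k.
Proof.
case=> Qi Qt cardQ; apply: fibers_connected => //.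
exact: eulerian_dtail.
Qed.

Lemma outer_pairing_bicoloring Q : outer_pairing Q ->
  exists eps, bichromatic eps P /\ bichromatic eps Q.
Proof.
case=> Qi Qt cardQ.
have [eps H] := fibers_bicoloring Pfpf Qi Ptail Qt (eulerian_dtail eulG) cardQ.
by exists eps; split=> h; case: (H h).
Qed.

Lemma connected_outer_pairing Q : fpf_involution Q ->
    (forall h, dtail (Q h) = dtail h) ->
    (forall h k, dtail h = dtail k -> pair_connect P Q h k) ->
  outer_pairing Q.
Proof.
move=> Qi Qt conn; split=> //; apply: fibers_card conn => //.
exact: eulerian_dtail.
Qed.

Lemma tperm_inner_commute h : tperm h (P h) * P = P * tperm h (P h).
Proof. by rewrite conjgC tpermJ PK tpermC. Qed.

(* Conjugation by a transposition commuting with [P] keeps the vertices. *)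
Lemma outer_pairingJ Q h : outer_pairing Q -> outer_pairing (Q ^ tperm h (P h)).
Proof.
case=> Qi Qt cardQ; split; first exact: fpf_involutionJ.
  have tt k : dtail (tperm h (P h) k) = dtail k by case: tpermP => [->|->|].
  by move=> k; rewrite -{1}(tpermK h (P h) k) permJ tt Qt tt.
have PJ : P ^ tperm h (P h) = P by rewrite conjgE -tperm_inner_commute mulKg.
by rewrite -{1}PJ -conjMg conjgE card_porbitsJ.
Qed.

(** This is the case of fibres over a one-point type; the number is 2 because a single outer face is
    traced in both directions. *)
Lemma outer_connectedP Q : fpf_involution Q ->
  (forall h k, pair_connect phi Q h k) <-> #|porbits (phi * Q)| = 2.
Proof.
move=> Qi; have fi := @edge_flip_fpf G.
have [d0 _] : exists d : dart G, true.
  by case: eulG => -[|d w] [/andP[/andP[]]] //; exists d.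
have surj (v : unit) : exists x : dart G, tt == v by case: v; exists d0.
have e2 : 2 = #|{: unit}|.*2 by rewrite card_unit.
split=> [H|H h k]; first by rewrite (fibers_card fi Qi _ _ surj) ?card_unit.
by apply: (fibers_connected fi Qi _ _ surj); rewrite ?card_unit.
Qed.

(** If each [h] shared its outer face with [P h], the face would be constant at every vertex, where
    [P] and [Q] connect all half-edges, and hence constant on [G]. *)
Lemma merge_outer Q : outer_pairing Q -> ~ (forall h k, pair_connect phi Q h k) ->
  exists h, (#|porbits (phi * Q ^ tperm h (P h))|).+2 = #|porbits (phi * Q)|.
Proof.
move=> outQ nconn; have fi := @edge_flip_fpf G; have [Qi Qt _] := outQ.
have [/existsP[h nh]|] := boolP [exists h, ~~ pair_connect phi Q h (P h)].
  by exists h; exact: merge_orbits.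
rewrite negb_exists => /forallP H; case: nconn => h k.
have sym := pair_connect_sym fi Qi.
pose K x := connect [rel x y | (y == phi x) || (y == Q x)] h x.
have Krefl : K h by exact: connect0.
have KE x y : pair_connect phi Q x y -> K x = K y.
  move=> xy; apply/idP/idP => [hx|hy]; first exact: connect_trans hx xy.
  by apply: connect_trans hy _; rewrite -[connect _]/(pair_connect _ _) sym.
suff E : K h = K k by rewrite -[pair_connect _ _ h k]/(K k) -E.
apply: (eulerian_invariant eulG) => [d|d d' dd'].
  by apply/esym/KE/connect1; rewrite /= edge_flipE eqxx.
have /connectP[p] := outer_pairing_connected outQ dd'.
elim: p d {dd'} => [|x p IHp] d /=; first by move=> _ ->.
case/andP=> dx xp /(IHp _ xp) <-; case/orP: dx => /eqP ->.
  by apply: KE; move: (H d); rewrite negbK.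
by apply/KE/connect1; rewrite /= eqxx orbT.
Qed.

Lemma exists_connected_outer Q : outer_pairing Q ->
  exists2 R, outer_pairing R & forall h k, pair_connect phi R h k.
Proof.
have [n] := ubnP #|porbits (phi * Q)|; elim: n Q => // n IHn Q ltn outQ.
have [Qi _ _] := outQ.
have [/eqP N2|N2] := boolP (#|porbits (phi * Q)| == 2).
  by exists Q => //; apply/(outer_connectedP Qi).
have nconn : ~ (forall h k, pair_connect phi Q h k).
  by move/(outer_connectedP Qi) => E; rewrite E in N2.
have [h Nh] := merge_outer outQ nconn.
apply: (IHn _ _ (outer_pairingJ h outQ)).
by rewrite -ltnS (leq_trans _ ltn) // -Nh.
Qed.

Definition bicolorable Q : Prop :=
  exists o, [/\ bichromatic o phi, bichromatic o P & bichromatic o Q].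

Definition forward_at (v : vertex G) : seq (dart G) :=
  [seq h <- enum (dart G) | forward decC h && (dtail h == v)].

(** The passes at a vertex are arranged one after the other in a cyclic order, each entering before
    it leaves. All three involutions then flip [forward]. *)
Lemma exists_bicolorable_outer : exists2 Q, outer_pairing Q & bicolorable Q.
Proof.
pose F h := forward_at (dtail h).
have FP h : F (P h) = F h by rewrite /F Ptail.
have FU h : uniq (F h) by rewrite filter_uniq // enum_uniq.
have mF h k : k \in F h = forward decC k && (dtail k == dtail h).
  by rewrite mem_filter mem_enum andbT.
have Ftail h k : k \in F h -> F k = F h.
  by rewrite mF => /andP[_ /eqP]; rewrite /F => ->.
have inF h : forward decC h -> h \in F h by rewrite mF eqxx andbT.
have fwP h : forward decC (P h) = ~~ forward decC h by exact: forward_inner.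
pose f h := if forward decC h then P (next (F h) h) else prev (F h) (P h).
have fK : involutive f.
  move=> h; rewrite {2}/f; case: ifPn => [hf|hf].
    have nF : next (F h) h \in F h by rewrite mem_next inF.
    have := nF; rewrite mF => /andP[nf _].
    by rewrite /f fwP nf /= FP (Ftail _ _ nF) PK prev_next.
  have pF : prev (F h) (P h) \in F h by rewrite mem_prev mF fwP hf Ptail eqxx.
  have := pF; rewrite mF => /andP[pf _].
  by rewrite /f pf (Ftail _ _ pF) next_prev // PK.
have ff h : forward decC (f h) = ~~ forward decC h.
  rewrite /f; case: ifPn => hf.
    by rewrite fwP; have := inF h hf; rewrite -mem_next mF => /andP[->].
  by have := inF (P h); rewrite fwP hf FP -mem_prev mF => /(_ isT)/andP[->].
have ft h : dtail (f h) = dtail h.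
  rewrite /f; case: ifPn => hf.
    by rewrite Ptail; have := inF h hf; rewrite -mem_next mF => /andP[_ /eqP].
  by have := inF (P h); rewrite fwP hf FP -mem_prev mF => /(_ isT)/andP[_ /eqP].
pose Q := perm (inv_inj fK).
have QE h : Q h = f h by rewrite permE.
have Qi : fpf_involution Q.
  move=> h; rewrite !QE fK; split=> //.
  by apply/eqP => /(congr1 (forward decC)); rewrite ff; case: forward.
exists Q; last first.
  exists (forward decC); split=> h; rewrite ?QE ?edge_flipE //.
  exact: forward_dflip.
apply: connected_outer_pairing => // [h|h k hk]; first by rewrite QE ft.
have sym := pair_connect_sym Pfpf Qi.
have fwd h' : exists2 d, d \in F h' & pair_connect P Q h' d.
  case: (boolP (forward decC h')) => hf.
    by exists h'; [exact: inF | exact: connect0].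
  exists (P h'); first by rewrite mF fwP hf Ptail eqxx.
  by apply: connect1; rewrite /= eqxx.
have [[d dF hd] [d' d'F kd']] := (fwd h, fwd k).
apply: connect_trans hd _; rewrite -[connect _]/(pair_connect P Q) sym.
apply: connect_trans kd' _; rewrite -[connect _]/(pair_connect P Q) sym.
have {}d'F : d' \in F h by rewrite /F hk.
have /connectP[p] := connect_cycle (cycle_next (FU h)) dF d'F.
elim: p d dF => [|x p IHp] d dF /=; first by move=> _ ->; exact: connect0.
case/andP=> /eqP nd xp E; have xF : x \in F h by rewrite -nd mem_next.
apply: connect_trans (IHp _ xF xp E); apply: (connect_trans (y := Q d)).
  by apply: connect1; rewrite /= eqxx orbT.
apply: connect1; apply/orP; left; rewrite QE /f -nd.
by have := dF; rewrite mF (Ftail _ _ dF) => /andP[-> _]; rewrite PK.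
Qed.

(* The pass of a circuit through [dtail h] with half-edges [h] and [P h] is a
   bridge of the incidence graph of circuits and vertices, whose edges are the
   passes: some 2-colouring [(p, g)] of its nodes is cut by this edge only. *)
Definition pass_bridge (h : dart G) : bool :=
  [exists p : {ffun vertex G -> bool}, [exists g : {ffun 'I_(size C) -> bool},
    [forall k, p (dtail k) (+) g (cidx k.1) == ((k == h) || (k == P h))]]].

Lemma pass_bridgeP h : reflect
  (exists (p : vertex G -> bool) (g : 'I_(size C) -> bool),
    forall k, p (dtail k) (+) g (cidx k.1) = ((k == h) || (k == P h)))
  (pass_bridge h).
Proof.
apply: (iffP existsP) => [[p /existsP[g /forallP H]]|[p [g H]]].
  by exists p, g => k; apply/eqP.
exists (finfun p); apply/existsP; exists (finfun g); apply/forallP => k.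
by rewrite !ffunE H.
Qed.

Definition incidence_tree : Prop := forall h, pass_bridge h.

Lemma twist_outer Q h : outer_pairing Q -> (forall h k, pair_connect phi Q h k) ->
    ~~ pass_bridge h -> bicolorable Q ->
  exists R, [/\ outer_pairing R, forall h k, pair_connect phi R h k
    & ~ bicolorable R].
Proof.
move=> outQ conn nbr [o [ophi oP oQ]]; have [Qi Qt _] := outQ.
set t := tperm h (P h); have outR : outer_pairing (Q ^ t) by exact: outer_pairingJ.
have tt k : dtail (t k) = dtail k by rewrite /t; case: tpermP => [->|->|].
have Ri : fpf_involution (Q ^ t) by case: outR.
exists (Q ^ t); split=> //.
  apply/(outer_connectedP Ri); apply: twist_orbits ophi oQ _ _.
  - exact: edge_flip_fpf.
  - by rewrite oP; case: (o h).
  - exact/(outer_connectedP Qi).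
case=> o' [o'phi o'P o'R]; case/negP: nbr; apply/pass_bridgeP.
(* [dv] is constant at vertices because [t] commutes with [P] and carries [Q] to its conjugate; [dc]
   is constant on circuits. Their sum compares [o'] at [k] and [t k], which differ only when [k] is
   [h] or [P h]. *)
pose dv k := o k (+) o' (t k); pose dc k := o k (+) o' k.
have dvE k k' : dtail k = dtail k' -> dv k = dv k'.
  have dvP x : dv (P x) = dv x.
    rewrite /dv -[t (P x)]permM -tperm_inner_commute permM oP o'P.
    by case: (o x); case: (o' _).
  have dvQ x : dv (Q x) = dv x.
    rewrite /dv -[t (Q x)](permJ Q t) oQ o'R.
    by case: (o x); case: (o' _).
  move=> /(outer_pairing_connected outQ)/connectP[p].
  elim: p k => [|x p IHp] k /=; first by move=> _ ->.
  by case/andP=> kx xp /(IHp _ xp) <-; case/orP: kx => /eqP ->.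
have dcE : forall k k', cidx k.1 = cidx k'.1 -> dc k = dc k'.
  apply: inner_pairing_invariant => k; rewrite /dc.
    by rewrite -edge_flipE ophi o'phi; case: (o k); case: (o' k).
  by rewrite oP o'P; case: (o k); case: (o' k).
exists (fun v => dv (xchoose (eulerian_dtail eulG v))).
exists (fun i => dc (xchoose (exists_circuit_dart i))) => k.
rewrite (dvE _ k); last exact/eqP/(xchooseP (eulerian_dtail eulG _)).
rewrite (dcE _ k); last exact/eqP/(xchooseP (exists_circuit_dart _)).
rewrite /dv /dc addbACA addbb /= /t; case: tpermP => [->|->|].
- by rewrite eqxx o'P addNb addbb.
- by rewrite eqxx orbT o'P addbN addbb.
by move=> /eqP/negbTE-> /eqP/negbTE->; rewrite addbb.
Qed.

(** A [P]-invariant [l] is a set of passes, and the cuts given by its individual bridges add up to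
    it modulo 2. *)
Lemma incidence_tree_potential (l : dart G -> bool) : incidence_tree ->
    (forall h, l (P h) = l h) ->
  exists (p : vertex G -> bool) (g : 'I_(size C) -> bool),
    forall h, p (dtail h) (+) g (cidx h.1) = l h.
Proof.
move=> tree; have [n] := ubnP #|l|; elim: n l => // n IHn l ltn lP.
have [h lh|l0] := pickP l; last first.
  by exists xpred0, xpred0 => h; rewrite l0.
pose l' k := l k (+) ((k == h) || (k == P h)).
have l'P k : l' (P k) = l' k.
  by rewrite /l' lP (inj_eq perm_inj) -(inj_eq (@perm_inj _ P) (P k)) PK orbC.
have /IHn/(_ l'P)[p' [g' E']] : #|l'| < n.
  rewrite -ltnS (leq_trans _ ltn) // ltnS; apply/proper_card/properP; split.
    apply/subsetP => k; rewrite !unfold_in /l'.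
    case: (k =P h) => [->|_]; first by rewrite lh.
    by case: (k =P P h) => [->|_]; rewrite ?lP ?lh ?addbF.
  by exists h => //; rewrite unfold_in /l' lh eqxx.
have /pass_bridgeP[p [g E]] := tree h.
exists (fun v => p v (+) p' v), (fun i => g i (+) g' i) => k.
by rewrite addbACA E E' /l' addbC addbK.
Qed.

(** Both [eps] and [forward] are flipped by [P], so their sum has a potential [(p, g)]. The
    colouring [eps + p] is flipped at vertices through [eps]; it equals [g + forward], so it is
    flipped along edges through [forward]. *)
Lemma incidence_tree_bicolorable Q : incidence_tree -> outer_pairing Q ->
  bicolorable Q.
Proof.
move=> tree outQ; have [_ Qt _] := outQ.
have [eps [epsP epsQ]] := outer_pairing_bicoloring outQ.
have [h|p [g E]] := incidence_tree_potential (l := fun h => eps h (+) forward decC h) tree.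
  by rewrite epsP (forward_inner decC innerP) addNb addbN negbK.
exists (fun h => eps h (+) p (dtail h)); split=> h; last 2 first.
- by rewrite epsP Ptail addNb.
- by rewrite epsQ Qt addNb.
have flipE k : eps k (+) p (dtail k) = g (cidx k.1) (+) forward decC k.
  by have := E k; case: (p _); case: (g _); case: (eps k); case: forward.
by rewrite edge_flipE !flipE forward_dflip addbN.
Qed.

(** A tree has one node more than it has edges, and its edges, the passes, correspond to the edges
    of [G] through their forward darts. Over two elements, a potential amounts to its coboundary and
    its value at [v0]; the resulting bijection gives the exponents of 2. *)
Lemma incidence_tree_card : incidence_tree ->
  (#|vertex G| + size C)%N = #|edge G|.+1.
Proof.
move=> tree; pose fd e : dart G := (e, forward decC (e, true)).
have fdE h : forward decC h -> fd h.1 = h.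
  case: h => e b; rewrite /fd /=; case: b => [-> //|].
  by rewrite -[(e, false)]/(dflip (e, true)) forward_dflip => /negbTE ->.
have fwfd e : forward decC (fd e).
  rewrite /fd; case: (boolP (forward decC (e, true))) => // H.
  by rewrite -[(e, false)]/(dflip (e, true)) forward_dflip H.
have [v0 _] : exists v : vertex G, true.
  by case: eulG => -[|d w] [/andP[/andP[]]] //; exists (dtail d).
pose F (x : {ffun vertex G -> bool} * {ffun 'I_(size C) -> bool}) :
    {ffun edge G -> bool} * bool :=
  ([ffun e => x.1 (dtail (fd e)) (+) x.2 (cidx e)], x.1 v0).
have F_surj y : exists x, F x = y.
  case: y => l b; pose l' h := l (if forward decC h then h else P h).1.
  have [h|p [g E]] := incidence_tree_potential (l := l') tree.
    by rewrite /l' (forward_inner decC innerP) PK; case: forward.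
  (* Adding the same constant to [p] and [g] keeps the coboundary and corrects the value at [v0]. *)
  pose c := p v0 (+) b.
  exists ([ffun v => p v (+) c], [ffun i => g i (+) c]).
  rewrite /F /= !ffunE /c addKb; congr pair; apply/ffunP => e; rewrite !ffunE /=.
  by rewrite addbACA addbb addbF (E (fd e)) /l' fwfd.
have F_inj : injective F.
  move=> [p g] [p' g'] [/ffunP E E0].
  have {}E h : p (dtail h) (+) g (cidx h.1) = p' (dtail h) (+) g' (cidx h.1).
    suff H k : forward decC k ->
        p (dtail k) (+) g (cidx k.1) = p' (dtail k) (+) g' (cidx k.1).
      case: (boolP (forward decC h)) => [/H //|hf].
      have := H (P h); rewrite (forward_inner decC innerP) hf Ptail.
      by rewrite (circuit_index_inner decC innerP); apply.
    by move=> kf; have := E k.1; rewrite !ffunE /= fdE.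
  have dE h k : p (dtail h) (+) p' (dtail h) = p (dtail k) (+) p' (dtail k).
    move: h k; apply: (eulerian_invariant eulG) => [d|d d' -> //].
    have H k : p (dtail k) (+) p' (dtail k) = g (cidx k.1) (+) g' (cidx k.1).
      by have := E k; case: (p _); case: (p' _); case: (g _); case: (g' _).
    by rewrite !H.
  have pE : p = p'.
    apply/ffunP => v; have [d /eqP <-] := eulerian_dtail eulG v.
    have [d0 /eqP d0E] := eulerian_dtail eulG v0.
    by apply: (@addIb (p' (dtail d))); rewrite (dE d d0) d0E [p v0]E0 !addbb.
  congr pair => //; apply/ffunP => i; have [h /eqP <-] := exists_circuit_dart i.
  by apply: (@addbI (p (dtail h))); rewrite E pE.
have : #|{: {ffun vertex G -> bool} * {ffun 'I_(size C) -> bool}}| =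
       #|{: {ffun edge G -> bool} * bool}|.
  apply/eqP; rewrite eqn_leq (leq_card _ F_inj) /=.
  have <- : #|F @: setT| = #|{: {ffun edge G -> bool} * bool}|.
    by apply: eq_card => y; have [x <-] := F_surj y; rewrite imset_f.
  by rewrite -cardsT leq_imset_card.
rewrite !card_prod !card_ffun card_bool card_ord -expnD -expnSr.
exact: expnI.
Qed.

(* A common 2-colouring fixes the parity of the number of outer faces, which a
   merging would change. *)
Lemma incidence_tree_connected Q : incidence_tree -> outer_pairing Q ->
  forall h k, pair_connect phi Q h k.
Proof.
move=> tree outQ; have [Qi Qt cardQ] := outQ.
have [/eqP N2|N2] := boolP (#|porbits (phi * Q)| == 2).
  exact/(outer_connectedP Qi).
have nconn : ~ (forall h k, pair_connect phi Q h k).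
  by move/(outer_connectedP Qi) => E; rewrite E in N2.
have [h Nh] := merge_outer outQ nconn.
have outR := outer_pairingJ h outQ; have [Ri Rt cardR] := outR.
have fi := @edge_flip_fpf G.
have [o [ophi oP oQ]] := incidence_tree_bicolorable tree outQ.
have [o' [o'phi o'P o'R]] := incidence_tree_bicolorable tree outR.
(* The term for the outer faces changes by one, while all other terms agree for [Q] and its
   conjugate. *)
have := parity_bicoloring Pfpf Qi fi oP oQ ophi.
have := parity_bicoloring Pfpf Ri fi o'P o'R o'phi.
rewrite odd_permJ cardQ cardR ![#|porbits (_ * phi)|]card_porbitsC -Nh /= => <-.
by do 3! case: (odd _).
Qed.

End Pairings.

(** * Embeddings and pairings *)

Section Rot.
Variable T : eqType.
Implicit Types s t : seq T.

Lemma rot_rot_ex s m n : exists k, rot m (rot n s) = rot k s.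
Proof.
case: (leqP m (size s)) => ms; last first.
  by exists n; rewrite [rot m _]rot_oversize // size_rot ltnW.
case: (leqP n (size s)) => ns; last first.
  by exists m; rewrite [rot n _]rot_oversize // ltnW.
by rewrite rot_add_mod //; eexists.
Qed.

Lemma rot_sym_ex s t n : s = rot n t -> exists k, t = rot k s.
Proof.
move=> ->; have [k E] := rot_rot_ex t (size t - n) n.
by exists (size (rot n t) - n)%N; rewrite -[LHS](rotK n).
Qed.

Lemma rev_rot_ex s n : exists k, rev (rot n s) = rot k (rev s).
Proof.
by exists (size (rev s) - n)%N; rewrite rev_rot.
Qed.

End Rot.

Section SameWalk.
Variable G : multigraph.
Implicit Types w : walk G.

Lemma rev_walkK : involutive (@rev_walk G).
Proof.
move=> w; rewrite /rev_walk map_rev revK -map_comp map_id_in // => d _ /=.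
exact: dflipK.
Qed.

Lemma same_walkP w1 w2 : reflect
  (exists n, w1 = rot n w2 \/ w1 = rot n (rev_walk w2)) (same_walk w1 w2).
Proof.
apply: (iffP existsP) => [[n /orP[]/eqP->]|[n E]]; [by exists n; left|by exists n; right|].
have szr : size (rev_walk w2) = size w2 by rewrite size_rev size_map.
case: (ltnP n (size w2).+1) => ns.
  by exists (Ordinal ns) => /=; case: E => <-; rewrite eqxx ?orbT.
exists ord0 => /=; rewrite !rot0.
by case: E => ->; rewrite rot_oversize ?szr 1?ltnW // eqxx ?orbT.
Qed.

Lemma same_walk_refl w : same_walk w w.
Proof. by apply/same_walkP; exists 0%N; left; rewrite rot0. Qed.

Lemma rev_walk_rot w n : exists k, rev_walk (rot n w) = rot k (rev_walk w).
Proof. by rewrite /rev_walk map_rot; apply: rev_rot_ex. Qed.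

Lemma same_walk_trans w1 w2 w3 : same_walk w1 w2 -> same_walk w2 w3 -> same_walk w1 w3.
Proof.
move=> /same_walkP[m E1] /same_walkP[n E2]; apply/same_walkP.
case: E1 E2 => -> [] ->; last 2 first.
- have [i ->] := rev_walk_rot w3 n; have [k ->] := rot_rot_ex (rev_walk w3) m i.
  by exists k; right.
- have [i ->] := rev_walk_rot (rev_walk w3) n; rewrite rev_walkK.
  by have [k ->] := rot_rot_ex w3 m i; exists k; left.
- by have [k ->] := rot_rot_ex w3 m n; exists k; left.
- by have [k ->] := rot_rot_ex (rev_walk w3) m n; exists k; right.
Qed.

Lemma same_walk_sym w1 w2 : same_walk w1 w2 -> same_walk w2 w1.
Proof.
move=> /same_walkP[m [E|E]]; apply/same_walkP; have [k E'] := rot_sym_ex E.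
  by exists k; left.
rewrite -[w2]rev_walkK E'; have [i ->] := rev_walk_rot w1 k.
by exists i; right.
Qed.

Lemma same_walk_mem w1 w2 : same_walk w1 w2 ->
  walk_edges w1 =i walk_edges w2.
Proof.
move=> /same_walkP[n [->|->]] e; rewrite /walk_edges map_rot mem_rot //.
by rewrite map_rev mem_rev -map_comp.
Qed.

Lemma same_walk_perm w1 w2 : same_walk w1 w2 ->
  perm_eq (walk_edges w1) (walk_edges w2).
Proof.
move=> /same_walkP[n [->|->]]; rewrite /walk_edges map_rot perm_rot //.
by rewrite map_rev perm_rev -map_comp.
Qed.

End SameWalk.

(** * Faces as classes of two involutions on face states *)

Section Faces.
Variables (G : multigraph) (M : embedding G).
Implicit Types (d h : dart G) (x y : face_state G).

Local Notation step := (face_step M).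
Local Notation rv := (face_reverse M).

Lemma face_reverseK : involutive rv.
Proof.
move=> [d s]; rewrite /face_reverse /= dflipK; congr pair.
by case: s; case: (twisted M _).
Qed.

(* The involution exchanging the two ends of a corner, in a state [(h, s)]
   seen as the half-edge [h] with one of its sides. *)
Definition corner x : face_state G :=
  if x.2 then (rotation M x.1, false) else ((rotation M)^-1 x.1, true).

Lemma cornerK : involutive corner.
Proof. by move=> [d []]; rewrite /corner /= ?permK ?permKV. Qed.

(** Tracing consists of going to the other end of the edge and of turning at a corner, two
    fixed-point-free involutions, so the results on such pairs apply to faces. *)
Lemma face_stepE x : step x = corner (rv x).
Proof. by rewrite /face_step /corner /=; case: (x.2 (+) _). Qed.

Definition face_reverse_perm : {perm face_state G} := perm (inv_inj face_reverseK).
Definition corner_perm : {perm face_state G} := perm (inv_inj cornerK).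

Lemma face_reverse_fpf : fpf_involution face_reverse_perm.
Proof.
move=> x; rewrite !permE face_reverseK; split=> //.
by apply/eqP => /(congr1 fst)/eqP; rewrite (negbTE (dflip_neq _)).
Qed.

Lemma corner_fpf : fpf_involution corner_perm.
Proof.
by move=> x; rewrite !permE cornerK; split=> //; case: x => d []; rewrite xpair_eqE andbF.
Qed.

Lemma face_step_perm x : (face_reverse_perm * corner_perm) x = step x.
Proof. by rewrite permM !permE face_stepE. Qed.

Lemma face_step_inj : injective step.
Proof. by move=> x y; rewrite -!face_step_perm; exact: perm_inj. Qed.

Lemma face_step_reverse x : step (rv (step x)) = rv x.
Proof. by rewrite !face_stepE face_reverseK cornerK. Qed.

Lemma mem_orbit_porbit x y :
  (y \in orbit step x) = (y \in porbit (face_reverse_perm * corner_perm) x).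
Proof.
rewrite -fconnect_orbit; apply/idP/porbitP => [/iter_findex <-|[i ->]].
  exists (findex step x y); rewrite permX.
  by elim: (findex _ _ _) => //= n ->; rewrite face_step_perm.
rewrite permX; suff -> : iter i (face_reverse_perm * corner_perm) x = iter i step x.
  exact: fconnect_iter.
by elim: i => //= n ->; rewrite face_step_perm.
Qed.

Lemma face_orbit_reverse x y : (rv y \in orbit step (rv x)) = (y \in orbit step x).
Proof.
have H z w : w \in orbit step z -> rv w \in orbit step (rv z).
  rewrite !mem_orbit_porbit => /(mem_porbit_fpf face_reverse_fpf corner_fpf).
  by rewrite !permE.
by apply/idP/idP => [/H|/H //]; rewrite !face_reverseK.
Qed.

Lemma face_orbit_sym x y : (y \in orbit step x) = (x \in orbit step y).
Proof. by rewrite -!fconnect_orbit (fconnect_sym face_step_inj). Qed.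

Lemma face_orbit_trans x y z :
  y \in orbit step x -> z \in orbit step y -> z \in orbit step x.
Proof. by rewrite -!fconnect_orbit; apply: connect_trans. Qed.

Lemma face_reverse_notin x : rv x \notin orbit step x.
Proof.
rewrite mem_orbit_porbit.
by have := fpf_notin_porbit face_reverse_fpf corner_fpf x; rewrite permE.
Qed.

Lemma same_faceE x y : connect (same_face M) x y =
  (y \in orbit step x) || (rv y \in orbit step x).
Proof.
have -> : connect (same_face M) x y = pair_connect face_reverse_perm corner_perm x y.
  have fE z : face_reverse_perm z = rv z by rewrite permE.
  have cE z : corner_perm z = corner z by rewrite permE.
  apply/idP/idP; apply: connect_sub => {}x {}y /orP[]/eqP->.
  - apply: (connect_trans (y := rv x)); apply: connect1; apply/orP; [left|right].
      by apply/eqP; rewrite fE.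
    by apply/eqP; rewrite cE face_stepE.
  - by apply: connect1; apply/orP; left; apply/eqP; rewrite fE.
  - by apply: connect1; apply/orP; right; apply/eqP; rewrite fE.
  - apply: (connect_trans (y := rv x)); apply: connect1; apply/orP; [right|left].
      by apply/eqP.
    by apply/eqP; rewrite cE face_stepE face_reverseK.
rewrite (pair_connectE face_reverse_fpf corner_fpf) -!mem_orbit_porbit permE.
by rewrite -(face_orbit_reverse x (rv y)) face_reverseK.
Qed.

Lemma same_face_sym : connect_sym (same_face M).
Proof.
move=> x y; rewrite !same_faceE face_orbit_sym.
by rewrite -[rv y \in _]face_orbit_reverse face_reverseK [rv x \in _]face_orbit_sym.
Qed.

Lemma facial_walk_orbit x y : y \in orbit step x ->
  same_walk (facial_walk M y) (facial_walk M x).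
Proof.
move=> xy; have := orbit_rot_cycle (cycle_orbit face_step_inj x) (orbit_uniq _ _) xy.
by case=> n E; apply/same_walkP; exists n; left; rewrite /facial_walk E map_rot.
Qed.

Lemma facial_walk_cycle x s : fcycle step s -> uniq s -> x \in s ->
  same_walk (facial_walk M x) [seq y.1 | y <- s].
Proof.
move=> fs Us xs; have [n E] := orbit_rot_cycle fs Us xs.
by apply/same_walkP; exists n; left; rewrite /facial_walk E map_rot.
Qed.

Lemma facial_walk_reverse x : same_walk (facial_walk M (rv x)) (facial_walk M x).
Proof.
apply: (same_walk_trans (w2 := [seq y.1 | y <- rev (map rv (orbit step x))])).
  apply: facial_walk_cycle; last by rewrite mem_rev map_f ?in_orbit.
    rewrite rev_cycle cycle_map; apply: sub_cycle (cycle_orbit face_step_inj x).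
    by move=> y z /= /eqP <-; rewrite face_step_reverse.
  by rewrite rev_uniq map_inj_uniq ?orbit_uniq //; exact: inv_inj face_reverseK.
apply/same_walkP; exists 0%N; right; rewrite rot0 /rev_walk map_rev.
by rewrite -!map_comp.
Qed.

Lemma facial_walk_same x y : connect (same_face M) x y ->
  same_walk (facial_walk M y) (facial_walk M x).
Proof.
rewrite same_faceE => /orP[/facial_walk_orbit //|xy].
apply: same_walk_trans (facial_walk_orbit xy).
by rewrite -{1}(face_reverseK y); exact: facial_walk_reverse.
Qed.

Lemma rotation_tail d : dtail (rotation M d) = dtail d.
Proof.
have := mem_porbit (rotation M) 1 d.
by rewrite expg1 rotation_at_vertex inE => /eqP.
Qed.

Lemma corner_tail x : dtail (corner x).1 = dtail x.1.
Proof.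
case: x => d [] /=; first exact: rotation_tail.
by rewrite -[in RHS](permKV (rotation M) d) rotation_tail.
Qed.

Lemma face_step_tail x : dtail (step x).1 = dhead x.1.
Proof. by rewrite face_stepE corner_tail. Qed.

Lemma facial_walk_closed x : closed_walk (facial_walk M x).
Proof.
apply/andP; split.
  by have := in_orbit step x; rewrite /facial_walk; case: (orbit _ _).
rewrite cycle_map; apply: sub_cycle (cycle_orbit face_step_inj x) => y z /= /eqP <-.
by rewrite face_step_tail.
Qed.

(* Each face is traced in one direction only in [facial_walks]. *)
Definition face_orbits (s : seq (face_state G)) := flatten [seq orbit step x | x <- s].

Lemma mem_face_orbits s y : reflect (exists2 x, x \in s & y \in orbit step x)
  (y \in face_orbits s).
Proof.
apply: (iffP flattenP) => [[t /mapP[x xs ->] yx]|[x xs yx]]; first by exists x.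
by exists (orbit step x) => //; apply: map_f.
Qed.

Lemma face_root_eq x y : roots (same_face M) x -> roots (same_face M) y ->
  connect (same_face M) x y -> x = y.
Proof.
move=> /eqP rx /eqP ry; rewrite -(root_connect same_face_sym) rx ry.
by move/eqP.
Qed.

Lemma uniq_face_orbits s : uniq s -> {subset s <= roots (same_face M)} ->
  uniq (face_orbits s).
Proof.
elim: s => //= x s IHs /andP[xs Us] sub.
have Uf : uniq (face_orbits s).
  by apply: IHs => // y ys; apply: sub; rewrite inE ys orbT.
rewrite /face_orbits /= cat_uniq orbit_uniq -/(face_orbits s) Uf andbT /=.
apply/hasPn => y /mem_face_orbits[z zs yz]; apply: contra xs => yx.
suff -> : x = z by [].
apply: face_root_eq; [exact/sub/mem_head|by apply: sub; rewrite inE zs orbT|].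
by rewrite same_faceE (face_orbit_trans yx) // face_orbit_sym.
Qed.

Lemma face_orbits_reverse s y : {subset s <= roots (same_face M)} ->
  y \in face_orbits s -> rv y \notin face_orbits s.
Proof.
move=> sub /mem_face_orbits[x xs yx]; apply/mem_face_orbits => -[z zs yz].
have xz : x = z.
  apply: face_root_eq; try exact: sub.
  rewrite same_faceE; apply/orP; right; apply: face_orbit_trans yx _.
  by rewrite face_orbit_sym -[y]face_reverseK face_orbit_reverse.
have := face_reverse_notin y; rewrite (face_orbit_trans _ yz) //.
by rewrite face_orbit_sym -xz.
Qed.

End Faces.

Section FaceCounts.
Variables (G : multigraph) (M : embedding G).
Implicit Types (h : dart G) (x y : face_state G) (s : seq (face_state G)).

Local Notation step := (face_step M).
Local Notation rv := (face_reverse M).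

Definition in_faces s y := (y \in face_orbits M s) || (rv y \in face_orbits M s).

Lemma face_walk_edges s :
  flatten [seq walk_edges w | w <- [seq facial_walk M x | x <- s]] =
  [seq y.1.1 | y <- face_orbits M s].
Proof.
rewrite /face_orbits map_flatten -!map_comp; congr flatten; apply: eq_map => x.
by rewrite /= /walk_edges -map_comp.
Qed.

(** Four states lie on the edge of [h], two for each side, exchanged by [face_reverse]. Each face is
    listed in one direction only, so a side contributes at most once. *)
Lemma count_face_edges s h : uniq s -> {subset s <= roots (same_face M)} ->
  count_mem h.1 (flatten [seq walk_edges w | w <- [seq facial_walk M x | x <- s]]) =
  in_faces s (h, false) + in_faces s (h, true).
Proof.
move=> Us sub; rewrite face_walk_edges count_map.
set O := face_orbits M s; have UO : uniq O by exact: uniq_face_orbits.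
pose sides := [:: (h, false); (h, true); (dflip h, false); (dflip h, true)].
have Usides : uniq sides.
  by rewrite /= !inE !xpair_eqE !eqxx /= !andbF !orbF /= [h == _]eq_sym
             !(negbTE (dflip_neq h)).
have -> : count (preim (fun y => y.1.1) (pred1 h.1)) O = count (mem O) sides.
  rewrite -!size_filter; apply/perm_size/uniq_perm; rewrite ?filter_uniq // => y.
  rewrite !mem_filter andbC /sides !inE /=; congr (_ && _).
  apply/eqP/idP => [/esym/dart_same_edge E|]; last by case/or4P=> /eqP->.
  by case: y E => d [] /= []->; rewrite eqxx ?orbT.
have excl y : (in_faces s y = (y \in O) + (rv y \in O) :> nat)%N.
  rewrite /in_faces -/O; case: (boolP (y \in O)) => [yO|_] /=; last by rewrite add0n.
  by rewrite (negbTE (face_orbits_reverse sub yO)).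
rewrite !excl /sides /= /face_reverse /=.
by case: (twisted M h.1); rewrite /= ?addn0; lia.
Qed.

Lemma in_faces_roots y : in_faces (enum (roots (same_face M))) y.
Proof.
pose r := fingraph.root (same_face M) y.
have : connect (same_face M) r y by rewrite same_face_sym connect_root.
rewrite same_faceE => /orP[]yr; apply/orP; [left|right];
  apply/mem_face_orbits; exists r => //; rewrite mem_enum;
  exact: roots_root (same_face_sym M) y.
Qed.

Lemma count_facial_walks e :
  count_mem e (flatten [seq walk_edges w | w <- facial_walks M]) = 2.
Proof.
have sub : {subset enum (roots (same_face M)) <= roots (same_face M)}.
  by move=> y; rewrite mem_enum.
by rewrite (count_face_edges (e, true) (enum_uniq _) sub) !in_faces_roots.
Qed.

Lemma in_faces_reverse s y : in_faces s (rv y) = in_faces s y.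
Proof. by rewrite /in_faces face_reverseK orbC. Qed.

Lemma in_faces_step s y : in_faces s (step y) = in_faces s y.
Proof.
have HO z : (step z \in face_orbits M s) = (z \in face_orbits M s).
  apply/mem_face_orbits/mem_face_orbits => -[x xs xz]; exists x => //.
    apply: face_orbit_trans xz _; rewrite face_orbit_sym.
    by rewrite -fconnect_orbit fconnect1.
  by apply: face_orbit_trans xz _; rewrite -fconnect_orbit fconnect1.
by rewrite /in_faces HO -[rv (step y) \in _]HO face_step_reverse.
Qed.

Lemma in_faces_corner s y : in_faces s (corner M y) = in_faces s y.
Proof.
by rewrite -[RHS]in_faces_reverse -[RHS]in_faces_step face_stepE face_reverseK.
Qed.

End FaceCounts.

(** Lifts a rearrangement of facial walks to one of the faces, since different faces may have equal
    walks. *)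
Lemma perm_eq_map_inv (T U : eqType) (f : T -> U) (s : seq T) (t : seq U) :
  perm_eq t (map f s) -> exists2 r, perm_eq r s & t = map f r.
Proof.
elim: t s => [|y t IHt] s pts.
  by exists [::] => //; have /perm_size := pts; case: s {pts}.
have /mapP[x xs yE] : y \in map f s by rewrite -(perm_mem pts) mem_head.
have ps := perm_to_rem xs; have [|r pr ->] := IHt (rem x s).
  rewrite -(perm_cons y) yE -map_cons -yE; apply: perm_trans pts _.
  exact: perm_map.
exists (x :: r); last by rewrite /= yE.
by rewrite (permPr ps) perm_cons.
Qed.

Lemma all2_map_cat (T U V : Type) (r : U -> V -> bool) (f : T -> U) s t1 t2 :
  all2 r (map f s) (t1 ++ t2) -> exists s1 s2,
    [/\ s = s1 ++ s2, all2 r (map f s1) t1 & all2 r (map f s2) t2].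
Proof.
elim: t1 s => [|y t1 IHt] s /=; first by exists [::], s.
case: s => //= x s /andP[xy /IHt[s1 [s2 [-> H1 H2]]]].
by exists (x :: s1), s2; rewrite /= xy.
Qed.

Lemma all2_same_walk_perm (G : multigraph) (U V : seq (walk G)) :
  all2 (@same_walk G) U V ->
  perm_eq (flatten [seq walk_edges w | w <- U]) (flatten [seq walk_edges w | w <- V]).
Proof.
elim: U V => [|u U IHU] [|v V] //= /andP[uv /IHU]; apply: perm_cat.
exact: same_walk_perm.
Qed.

Lemma all2_mem (T U : eqType) (r : T -> U -> bool) s t y :
  all2 r s t -> y \in t -> exists2 x, x \in s & r x y.
Proof.
elim: s t => [|x s IHs] [|z t] //= /andP[xz st]; rewrite inE => /predU1P[->|yt].
  by exists x; rewrite ?mem_head.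
by have [x' x's ry] := IHs _ st yt; exists x'; rewrite ?inE ?x's ?orbT.
Qed.

(** * From outer pairings to relative embeddings *)

Section Framed.
Variables (G : multigraph) (C : seq (walk G)) (P : {perm dart G}).
Hypotheses (eulG : eulerian G) (decC : circuit_decomposition C).
Hypothesis innerP : inner_pairing C P.
Implicit Types (h k : dart G) (M : embedding G) (Q : {perm dart G}).

Let Pfpf : fpf_involution P. Proof. by case: innerP. Qed.
Let PK : involutive P. Proof. by move=> h; case: (Pfpf h). Qed.
Let Ptail h : dtail (P h) = dtail h. Proof. by case: innerP. Qed.

(* [M] is an embedding relative to [C]: the inner corner at the half-edge [h] is
   on the side [eps h] of [h], and [P] and [Q] exchange the two half-edges of
   the inner and of the outer corners. *)
Record framed M (eps : dart G -> bool) Q : Prop := Framed {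
  framed_inner : bichromatic eps P;
  framed_outer : bichromatic eps Q;
  framed_rotation : forall h, rotation M h = if eps h then P h else Q h;
  framed_twisted : forall h, eps (dflip h) = ~~ (eps h (+) twisted M h.1)
}.

Lemma framed_outer_pairing M eps Q : fpf_involution Q -> framed M eps Q ->
  outer_pairing P Q.
Proof.
move=> Qi [epsP epsQ rotE _]; have QK : involutive Q by move=> h; case: (Qi h).
apply: (connected_outer_pairing eulG innerP) => // [h|h k hk].
  case eh: (eps h).
    by have := rotation_tail M (Q h); rewrite rotE epsQ eh QK => ->.
  by have := rotation_tail M h; rewrite rotE eh.
have : k \in porbit (rotation M) h by rewrite rotation_at_vertex inE hk.
case/porbitP=> i ->; elim: i => [|i IHi]; first by rewrite expg0 perm1; exact: connect0.
apply: connect_trans IHi _; apply: connect1; rewrite expgSr permM rotE /=.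
by case: (eps _); rewrite eqxx ?orbT.
Qed.

Lemma outer_pairing_framed Q : outer_pairing P Q -> exists M eps, framed M eps Q.
Proof.
move=> outQ; have [Qi Qt _] := outQ.
have [eps [epsP epsQ]] := outer_pairing_bicoloring eulG innerP outQ.
pose rho := alternate epsP epsQ.
have QK : involutive Q by move=> h; case: (Qi h).
have rhoE h : rho h = if eps h then P h else Q h by exact: alternateE.
have rhoV h k : porbit rho h = [set k | dtail k == dtail h].
  apply/setP => x; rewrite inE; apply/idP/eqP => [|xh].
    by apply: porbit_invariant => y; rewrite rhoE; case: (eps y).
  have /connectP[p] := outer_pairing_connected eulG innerP outQ (esym xh).
  have porbS y : porbit rho (rho y) = porbit rho y.
    by rewrite -(porbit_perm rho 1 y) expg1.
  have porbP y : porbit rho (P y) = porbit rho y.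
    case ey: (eps y); first by rewrite -[RHS]porbS rhoE ey.
    by rewrite -[LHS]porbS rhoE epsP ey PK.
  have porbQ y : porbit rho (Q y) = porbit rho y.
    case ey: (eps y); last by rewrite -[RHS]porbS rhoE ey.
    by rewrite -[LHS]porbS rhoE epsQ ey QK.
  elim: p h {xh} => [|y p IHp] h /=; first by move=> _ ->; exact: porbit_id.
  by case/andP=> hy yp /(IHp _ yp); case/orP: hy => /eqP ->; rewrite ?porbP ?porbQ.
(* The inner side at one end of an edge must continue as the inner side at the other end, which
   forces the signature. *)
pose tw e := ~~ (eps (e, false) (+) eps (e, true)).
exists (Embedding tw (fun h => rhoV h h)), eps; split=> // -[e b] /=.
by rewrite /tw /dflip /=; case: b; case: (eps (e, true)); case: (eps (e, false)).
Qed.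

Section OneEmbedding.
Variables (M : embedding G) (eps : dart G -> bool) (Q : {perm dart G}).
Hypotheses (Qi : fpf_involution Q) (frame : framed M eps Q).

Local Notation step := (face_step M).
Local Notation rv := (face_reverse M).

Let QK : involutive Q. Proof. by move=> h; case: (Qi h). Qed.

Let outQ : outer_pairing P Q.
Proof. exact: framed_outer_pairing frame. Qed.

(** These states trace the inner faces: [corner] acts as [P] on them and as [Q] on the others, and
    [face_reverse] acts as the edge flip on both kinds. *)
Definition inner_state (y : face_state G) := y.2 == eps y.1.

Lemma reverse_inner h : rv (h, eps h) = (dflip h, eps (dflip h)).
Proof. by case: frame => _ _ _ ->. Qed.

Lemma reverse_outer h : rv (h, ~~ eps h) = (dflip h, ~~ eps (dflip h)).
Proof. by case: frame => _ _ _ ->; rewrite /face_reverse /= addNb !negbK. Qed.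

Lemma corner_inner h : corner M (h, eps h) = (P h, eps (P h)).
Proof.
case: frame => epsP epsQ rotE _; rewrite /corner /= epsP; case eh: (eps h) => /=.
  by rewrite rotE eh.
congr pair; apply: (@perm_inj _ (rotation M)).
by rewrite permKV rotE epsP eh /= PK.
Qed.

Lemma corner_outer h : corner M (h, ~~ eps h) = (Q h, ~~ eps (Q h)).
Proof.
case: frame => epsP epsQ rotE _; rewrite /corner /= epsQ; case eh: (eps h) => /=.
  congr pair; apply: (@perm_inj _ (rotation M)).
  by rewrite permKV rotE epsQ eh /= QK.
by rewrite rotE eh.
Qed.

Lemma inner_stateP y : reflect (y = (y.1, eps y.1)) (inner_state y).
Proof. by case: y => h s; apply: (iffP eqP) => [/= ->|[]]. Qed.

Lemma outer_stateP y : reflect (y = (y.1, ~~ eps y.1)) (~~ inner_state y).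
Proof.
case: y => h s; rewrite /inner_state /=; apply: (iffP idP) => [|[->]].
  by case: s; case: (eps h).
by case: (eps h).
Qed.

Lemma inner_state_reverse y : inner_state (rv y) = inner_state y.
Proof.
have [/inner_stateP-> | /outer_stateP->] := boolP (inner_state y).
  by rewrite reverse_inner /inner_state /= eqxx.
by rewrite reverse_outer /inner_state /=; case: eps.
Qed.

Lemma inner_state_corner y : inner_state (corner M y) = inner_state y.
Proof.
have [/inner_stateP-> | /outer_stateP->] := boolP (inner_state y).
  by rewrite corner_inner /inner_state /= eqxx.
by rewrite corner_outer /inner_state /=; case: eps.
Qed.

Lemma inner_state_connect x y : connect (same_face M) x y ->
  inner_state x = inner_state y.
Proof.
move=> /connectP[p]; elim: p x => [|z p IHp] x /=; first by move=> _ ->.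
case/andP=> xz zp /(IHp _ zp) <-; case/orP: xz => /eqP ->.
  by rewrite face_stepE inner_state_corner inner_state_reverse.
by rewrite inner_state_reverse.
Qed.

Lemma outer_state_connect h k : pair_connect (edge_flip G) Q h k ->
  connect (same_face M) (h, ~~ eps h) (k, ~~ eps k).
Proof.
move=> /connectP[p]; elim: p h => [|x p IHp] h /=; first by move=> _ ->.
case/andP=> hx xp /(IHp _ xp); apply: connect_trans; case/orP: hx => /eqP ->.
  by apply: connect1; apply/orP; right; rewrite edge_flipE reverse_outer.
apply: (connect_trans (y := rv (h, ~~ eps h))); apply: connect1; apply/orP; [right|left].
  exact: eqxx.
by rewrite face_stepE face_reverseK corner_outer.
Qed.

(** Local orientations [o] correspond to the colouring [eps + o], because reversing a vertex
    exchanges the two sides of its half-edges. *)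
Lemma framed_orientable : orientable M <-> bicolorable P Q.
Proof.
case: frame => epsP epsQ rotE epsf; split=> [/existsP[o /forallP H]|[o [ophi oP oQ]]].
  have {}H h : twisted M h.1 = o (dtail h) (+) o (dhead h).
    by case: h => e [] /=; rewrite (eqP (H e)) /dtail /dhead //= addbC.
  have [_ Qt _] := outQ.
  exists (fun h => eps h (+) o (dtail h)); split=> h; last 2 first.
  - by rewrite epsP Ptail addNb.
  - by rewrite epsQ Qt addNb.
  rewrite edge_flipE epsf H dtail_dflip.
  by case: (eps h); case: (o (dtail h)); case: (o (dhead h)).
pose f h := eps h (+) o h.
have fE h k : dtail h = dtail k -> f h = f k.
  move=> /(outer_pairing_connected eulG innerP outQ)/connectP[p].
  elim: p h => [|x p IHp] h /=; first by move=> _ ->.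
  case/andP=> hx xp /(IHp _ xp) <-; rewrite /f.
  by case/orP: hx => /eqP ->; rewrite ?epsP ?epsQ ?oP ?oQ addNb addbN negbK.
apply/existsP; exists [ffun v => f (xchoose (eulerian_dtail eulG v))].
apply/forallP => e; rewrite !ffunE.
rewrite (fE _ (e, false)); last exact: (eqP (xchooseP (eulerian_dtail eulG (ends e false)))).
rewrite [X in _ (+) X](fE _ (dflip (e, false))); last first.
  exact: (eqP (xchooseP (eulerian_dtail eulG (ends e true)))).
rewrite /f epsf -edge_flipE ophi /=.
by case: (eps _); case: (o _); case: (twisted M e).
Qed.

(** Lifted to inner states, a circuit of [C] is a whole face orbit; every inner face arises from
    exactly one circuit, as an edge determines its circuit. *)
Lemma framed_relative :
  relative_embedding M C
    [seq facial_walk M x | x <- enum (roots (same_face M)) & ~~ inner_state x].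
Proof.
split; first by apply/allP => w /mapP[x _ ->]; exact: facial_walk_closed.
have [d0 _] : exists d : dart G, true.
  by case: eulG => -[|d w] [/andP[/andP[]]] //; exists d.
pose st h : face_state G := (h, eps h).
pose rt w := fingraph.root (same_face M) (st (head d0 w)).
have sym := same_face_sym M.
have st_step h : step (st h) = st (P (dflip h)).
  by rewrite face_stepE /st reverse_inner corner_inner.
have st_cycle w : w \in C -> fcycle step (map st w).
  move=> wC; rewrite cycle_map; case: innerP => _ _ /(_ w wC).
  by apply: sub_cycle => d d' /eqP <-; rewrite /= st_step.
have st_uniq w : w \in C -> uniq (map st w).
  move=> /(decomposition_circuit decC)/circuit_uniq Uw.
  by rewrite map_inj_uniq // => h k [].
have head_in w : w \in C -> head d0 w \in w.
  by move=> /(decomposition_circuit decC); case: w => // d w _; exact: mem_head.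
have st_conn w h : w \in C -> h \in w -> connect (same_face M) (st (head d0 w)) (st h).
  move=> wC hw; rewrite same_faceE.
  rewrite (in_orbit_cycle (st_cycle w wC)) ?map_f ?head_in //.
have walk_rt w : w \in C -> same_walk (facial_walk M (rt w)) w.
  move=> wC; have := facial_walk_cycle (st_cycle w wC) (st_uniq w wC).
  move=> /(_ (st (head d0 w)) (map_f _ (head_in w wC))).
  rewrite -map_comp map_id; apply: same_walk_trans.
  by apply: facial_walk_same; exact: connect_root.
exists ([seq facial_walk M (rt w) | w <- C] ++
    [seq facial_walk M x | x <- enum (roots (same_face M)) & ~~ inner_state x]); last first.
  set W' := map _ (filter _ _); have refl : all2 (@same_walk G) W' W'.
    by elim: W' => //= w W' ->; rewrite same_walk_refl.
  elim: C walk_rt => //= w C' IHC walk_rt; rewrite walk_rt ?mem_head ?IHC // => w' w'C.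
  by apply: walk_rt; rewrite inE w'C orbT.
have inner_rt w : inner_state (rt w).
  by rewrite -(inner_state_connect (connect_root _ _)) /inner_state /= eqxx.
rewrite (map_comp (facial_walk M) rt) -map_cat; apply: perm_map.
have roots_rt w : rt w \in enum (roots (same_face M)).
  by rewrite mem_enum; exact: roots_root.
apply: uniq_perm; rewrite ?enum_uniq //.
  rewrite cat_uniq filter_uniq ?enum_uniq // andbT; apply/andP; split; last first.
    by apply/hasPn => x; rewrite mem_filter => /andP[nx _]; apply: contra nx => /mapP[w _ ->].
  rewrite map_inj_in_uniq => [|w w' wC w'C E].
    apply/(uniqP [::]) => i j; rewrite !inE => iC jC E.
    have wC := mem_nth [::] iC; have dw := head_in _ wC.
    have ei : (head d0 (nth [::] C i)).1 \in walk_edges (nth [::] C i).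
      by rewrite mem_walk_edges dw.
    rewrite (circuit_index_nth decC ei); rewrite E in ei.
    by rewrite (circuit_index_nth decC ei) E.
  have ew : (head d0 w).1 \in walk_edges w by rewrite mem_walk_edges head_in.
  rewrite (circuit_of_unique decC wC ew); apply/esym/circuit_of_unique => //.
  by rewrite -(same_walk_mem (walk_rt _ w'C)) -E (same_walk_mem (walk_rt _ wC)).
move=> x; rewrite mem_cat mem_filter; apply/orP/idP => [[/mapP[w _ ->] //|/andP[] //]|xr].
case: (boolP (inner_state x)) => [/inner_stateP xE|nx]; [left|by right].
pose w := circuit_of decC x.1.1; have wC : w \in C by exact: circuit_of_mem.
have /eqP <- : roots (same_face M) x by rewrite mem_enum in xr.
apply/mapP; exists w => //; apply/eqP; rewrite eq_sym root_connect //.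
have := circuit_ofP decC x.1.1; rewrite mem_walk_edges => /orP[] xw.
  by rewrite xE; exact: st_conn.
apply: connect_trans (st_conn _ _ wC xw) _; rewrite sym; apply: connect1.
by apply/orP; right; rewrite {2}xE reverse_inner.
Qed.

Lemma framed_one_face : (forall h k, pair_connect (edge_flip G) Q h k) ->
  exists w, relative_embedding M C [:: w].
Proof.
move=> conn; have := framed_relative.
case E: [seq x <- enum (roots (same_face M)) | ~~ inner_state x] => [|x s].
  have [d0 _] : exists d : dart G, true.
    by case: eulG => -[|d w] [/andP[/andP[]]] //; exists d.
  pose x := fingraph.root (same_face M) (d0, ~~ eps d0).
  have : x \in [::].
    rewrite -E mem_filter mem_enum; apply/andP; split; last exact: roots_root (same_face_sym M) _.
    rewrite -(inner_state_connect (connect_root _ _)) /inner_state /=.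
    by case: eps.
  by [].
suff -> : s = [::] by exists (facial_walk M x).
have : uniq (x :: s) by rewrite -E filter_uniq // enum_uniq.
case: s E => // y s E /=; rewrite inE negb_or => /andP[/andP[/eqP xy _] _].
have mem z : z \in [:: x, y & s] -> ~~ inner_state z /\ roots (same_face M) z.
  by rewrite -E mem_filter mem_enum => /andP[].
have [|/outer_stateP xE rx] := mem x; first exact: mem_head.
have [|/outer_stateP yE ry] := mem y; first by rewrite !inE eqxx orbT.
case: xy; apply: face_root_eq rx ry _; rewrite xE yE.
exact/outer_state_connect/conn.
Qed.

End OneEmbedding.

End Framed.

(** * From relative embeddings to outer pairings *)

Section Relative.
Variables (G : multigraph) (C : seq (walk G)) (P : {perm dart G}).
Hypotheses (eulG : eulerian G) (decC : circuit_decomposition C).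
Hypothesis innerP : inner_pairing C P.
Implicit Types (h k : dart G) (M : embedding G) (Q : {perm dart G}).

Lemma relative_faces M (W1 W2 : seq (walk G)) : same_walks (facial_walks M) (W1 ++ W2) ->
  exists X1 X2, [/\ perm_eq (X1 ++ X2) (enum (roots (same_face M))),
    all2 (@same_walk G) [seq facial_walk M x | x <- X1] W1
  & all2 (@same_walk G) [seq facial_walk M x | x <- X2] W2].
Proof.
by case=> W /perm_eq_map_inv[X pX ->] /all2_map_cat[X1 [X2 [E H1 H2]]];
  exists X1, X2; rewrite -E.
Qed.

Lemma relative_framed M W' : relative_embedding M C W' ->
  exists eps Q, [/\ fpf_involution Q, framed P M eps Q
    & exists X, [/\ all2 (@same_walk G) [seq facial_walk M x | x <- X] W',
        uniq X & forall x, x \in X -> roots (same_face M) x /\ ~~ inner_state eps x]].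
Proof.
case=> _ /relative_faces[X1 [X2 [pX wX1 wX2]]].
have := perm_uniq pX; rewrite enum_uniq cat_uniq => /and3P[U1 /hasPn D12 U2].
have rX x : x \in X1 ++ X2 -> roots (same_face M) x.
  by rewrite (perm_mem pX) mem_enum.
have sub : {subset X1 <= roots (same_face M)}.
  by move=> x x1; apply: rX; rewrite mem_cat x1.
pose eps h := in_faces M X1 (h, true).
(* The edge of [h] occurs once in [C], and this multiplicity is the number of inner sides of [h]. *)
have inE1 h s : in_faces M X1 (h, s) = (s == eps h).
  have := count_face_edges h U1 sub; rewrite (seq.permP (all2_same_walk_perm wX1)).
  case: decC => _ /seq.permP ->; rewrite count_uniq_mem ?enum_uniq // mem_enum.
  by rewrite /eps; case: s; case: (in_faces _ _ (h, true)); case: in_faces.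
have epsR h : eps (rotation M h) = ~~ eps h.
  have := in_faces_corner M X1 (h, true); rewrite /corner /= !inE1.
  by case: (eps h); case: (eps _).
have epsRV h : eps ((rotation M)^-1 h) = ~~ eps h.
  by rewrite -{2}(permKV (rotation M) h) epsR negbK.
(* [turn false] crosses the inner corner at [h], and [turn true] the outer one. *)
pose turn (b : bool) h := if b (+) eps h then rotation M h else (rotation M)^-1 h.
have turnK b : involutive (turn b).
  move=> h; rewrite {2}/turn; case E: (b (+) eps h); rewrite /turn.
    by rewrite epsR addbN E /= permK.
  by rewrite epsRV addbN E /= permKV.
have turn_eps b h : eps (turn b h) = ~~ eps h.
  by rewrite /turn; case: ifP => _; rewrite ?epsR ?epsRV.
have turnE b h : perm (inv_inj (turnK b)) h = turn b h by rewrite permE.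
(* The inner facial walks follow [turn false]; hence so do the circuits, which determine the
   pairing. *)
have PE : P =1 perm (inv_inj (turnK false)).
  apply: (inner_pairing_unique decC innerP) => [h|w wC]; first by rewrite !turnE turnK.
  have QK : involutive (perm (inv_inj (turnK false))) by move=> h; rewrite !turnE turnK.
  have [_ /mapP[x x1 ->] xw] := all2_mem wX1 wC.
  suff F : follows (perm (inv_inj (turnK false))) (facial_walk M x).
    move/same_walk_sym/same_walkP: xw => [n [->|->]]; rewrite rot_cycle //.
    exact: (etrans (follows_rev _ QK) F).
  rewrite /follows cycle_map.
  have cx := cycle_orbit (@face_step_inj _ M) x.
  apply: (sub_in_cycle (P := in_faces M X1)) cx => [y z yin _ /eqP <-|].
    rewrite face_stepE; apply/eqP; rewrite /= turnE /corner /turn /=.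
    have := yin; rewrite -topredE /= -in_faces_reverse /face_reverse inE1 => /eqP ->.
    by case: (eps _).
  apply/allP => y yx; apply/orP; left; apply/mem_face_orbits; by exists x.
exists eps, (perm (inv_inj (turnK true))); split.
- move=> h; rewrite !turnE turnK; split=> //.
  by apply/eqP => /(congr1 eps); rewrite turn_eps; case: (eps h).
- split=> h; rewrite ?turnE ?PE ?turnE ?turn_eps //; first by rewrite /turn; case: (eps h).
  have := in_faces_reverse M X1 (h, eps h); rewrite /face_reverse !inE1 eqxx /=.
  by move/eqP.
exists X2; split=> // x x2; have rx : roots (same_face M) x by apply: rX; rewrite mem_cat x2 orbT.
split=> //; rewrite /inner_state; case: x x2 rx => h s x2 rx /=; rewrite -inE1.
apply: (contraNN _ (D12 _ x2)) => /orP xX1.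
have [z z1 zx] : exists2 z, z \in X1 & connect (same_face M) z (h, s).
  by case: xX1 => /mem_face_orbits[z z1 zx]; exists z; rewrite // same_faceE zx ?orbT.
by rewrite -(face_root_eq (sub _ z1) rx zx).
Qed.

(* Each edge lies on two faces, counted with multiplicity, one of them inner. *)
Lemma relative_count M W' e : relative_embedding M C W' ->
  count_mem e (flatten [seq walk_edges w | w <- W']) = 1%N.
Proof.
case=> _ [W pW /all2_same_walk_perm/seq.permP/(_ (pred1 e))].
rewrite map_cat flatten_cat count_cat.
have -> : count_mem e (flatten [seq walk_edges w | w <- W]) = 2.
  by rewrite -(count_facial_walks M e); apply/seq.permP/perm_flatten/perm_map.
case: decC => _ /seq.permP ->; rewrite count_uniq_mem ?enum_uniq // mem_enum /=.
by rewrite add1n => -[].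
Qed.

Lemma relative_size M W' : relative_embedding M C W' ->
  size (facial_walks M) = size C + size W'.
Proof.
case=> _ [W /perm_size <-]; rewrite all2E => /andP[/eqP -> _].
by rewrite size_cat.
Qed.

Lemma relative_gt0 M W' : nontrivial G -> relative_embedding M C W' -> 0 < size W'.
Proof. by case=> e _ /(@relative_count _ _ e); case: W'. Qed.

Lemma relative_euler_circuit M w : relative_embedding M C [:: w] -> euler_circuit w.
Proof.
move=> rel; have [/=/andP[cw _] _] := rel.
have cnt e : count_mem e (walk_edges w) = 1%N.
  by have := relative_count e rel; rewrite /= cats0.
have we e : e \in walk_edges w by rewrite -has_pred1 has_count cnt.
split=> //.
  by rewrite /circuit cw; apply: count_mem_uniq => e; rewrite cnt we.
move=> v; have [d /eqP <-] := eulerian_dtail eulG v.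
have := we d.1; rewrite mem_walk_edges => /orP[dw|dw]; first exact: map_f.
by rewrite -(dflipK d) dtail_dflip (closed_walk_next cw dw) map_f // mem_next.
Qed.

Lemma incidence_tree_one_face M W' : nontrivial G -> incidence_tree P decC ->
  relative_embedding M C W' -> size W' = 1%N.
Proof.
move=> ntG tree rel; have := relative_gt0 ntG rel.
have [eps [Q [Qi frame [X [XW UX HX]]]]] := relative_framed rel.
have outQ := framed_outer_pairing eulG innerP Qi frame.
have conn := incidence_tree_connected eulG innerP tree outQ.
have <- : size X = size W' by move: XW; rewrite all2E size_map => /andP[/eqP].
case: X UX HX {XW} => [|x [|y s]] //=; rewrite inE negb_or => /andP[/andP[/eqP xy _] _].
move=> HX _; have [rx /outer_stateP xE] := HX x (mem_head _ _).
have [|ry /outer_stateP yE] := HX y; first by rewrite !inE eqxx orbT.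
case: xy; apply: face_root_eq rx ry _; rewrite xE yE.
exact: (outer_state_connect Qi frame (conn _ _)).
Qed.

Lemma incidence_tree_orientable M W' : incidence_tree P decC ->
  relative_embedding M C W' -> orientable M.
Proof.
move=> tree rel; have [eps [Q [Qi frame _]]] := relative_framed rel.
have outQ := framed_outer_pairing eulG innerP Qi frame.
apply/(framed_orientable eulG innerP Qi frame).
exact: (incidence_tree_bicolorable eulG innerP tree).
Qed.

End Relative.

(** * Parity of the Euler characteristic of orientable embeddings *)

Lemma card_imset_ker (T U V : finType) (f : T -> U) (g : T -> V) :
  (forall x y, (f x == f y) = (g x == g y)) -> #|f @: T| = #|g @: T|.
Proof.
move=> fg; pose h x := (f x, g x).
have -> : f @: T = fst @: (h @: T) by rewrite -imset_comp.
have -> : g @: T = snd @: (h @: T) by rewrite -imset_comp.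
have inj1 : {in h @: T &, injective fst}.
  move=> u v /imsetP[x _ ->] /imsetP[y _ ->] /= E; congr pair => //.
  by apply/eqP; rewrite -fg E.
have inj2 : {in h @: T &, injective snd}.
  move=> u v /imsetP[x _ ->] /imsetP[y _ ->] /= E; congr pair => //.
  by apply/eqP; rewrite fg E.
by rewrite (card_in_imset inj1) (card_in_imset inj2).
Qed.

Lemma card_roots (T : finType) (e : rel T) (U : finType) (f : T -> U) :
  connect_sym e -> (forall x y, connect e x y = (f x == f y)) ->
  #|roots e| = #|f @: T|.
Proof.
move=> sym ef; have -> : f @: T = f @: [set x | roots e x].
  apply/setP => u; apply/imsetP/imsetP => [[x _ ->]|[x _ ->]]; last by exists x.
  exists (fingraph.root e x); first by rewrite inE; exact: roots_root.
  by apply/eqP; rewrite -ef connect_root.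
rewrite card_in_imset; first by apply: eq_card => x; rewrite inE.
move=> x y; rewrite !inE => /eqP rx /eqP ry /eqP; rewrite -ef -(root_connect sym) rx ry.
by move/eqP.
Qed.

Lemma card_fpf_porbits (T : finType) (a : {perm T}) :
  fpf_involution a -> #|porbits a|.*2 = #|T|.
Proof.
move=> ai; have orbE x : porbit a x = [set x; a x].
  apply/setP => y; rewrite !inE; apply/idP/orP => [/porbitP[i ->]|[]/eqP->].
  - elim: i => [|i IHi]; first by rewrite expg0 perm1; left.
    rewrite expgSr permM; case: IHi => /eqP->; first by right.
    by case: (ai x) => -> _; left.
  - exact: porbit_id.
  by have := mem_porbit a 1 x; rewrite expg1.
rewrite -[RHS]sum1_card [RHS](partition_big (porbit a) (mem (porbits a))) /=; last first.
  by move=> x _; exact: imset_f.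
rewrite -muln2 -sum_nat_const; apply: eq_bigr => A /imsetP[x _ ->].
rewrite sum1dep_card; transitivity #|[set x; a x]|.
  by rewrite cards2; case: (ai x) => _; rewrite eq_sym => ->.
by apply: eq_card => y; rewrite -orbE inE eq_porbit_mem.
Qed.

Section Orientable.
Variables (G : multigraph) (M : embedding G).
Hypothesis eulG : eulerian G.

(** Untwisting by [o] yields a permutation [rho] whose orbits are the vertices; those of
    [edge_flip G] are the edges and those of the product are the faces, each counted once.
    Multiplicativity of the sign gives the parity, which makes the halving in [genus] exact. *)
Lemma orientable_even : orientable M ->
  ~~ odd (#|vertex G| + #|edge G| + size (facial_walks M)).
Proof.
case/existsP=> o /forallP H.
have twE h : twisted M h.1 = o (dtail h) (+) o (dhead h).
  by case: h => e [] /=; rewrite (eqP (H e)) /dtail /dhead //= addbC.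
pose r h := if o (dtail h) then (rotation M)^-1 h else rotation M h.
have rtail h : dtail (r h) = dtail h.
  rewrite /r; case: ifP => _; last exact: rotation_tail.
  by rewrite -[in RHS](permKV (rotation M) h) rotation_tail.
have r_inj : injective r.
  move=> h k E; have : dtail h = dtail k by rewrite -rtail E rtail.
  by move: E; rewrite /r => + Ed; rewrite Ed; case: ifP => _; exact: perm_inj.
pose rho := perm r_inj.
have rhoE h k : (k \in porbit rho h) = (dtail k == dtail h).
  apply/idP/eqP => [|hk].
    by apply: porbit_invariant => x; rewrite permE rtail.
  have : k \in porbit (if o (dtail h) then (rotation M)^-1 else rotation M) h.
    by case: ifP => _; rewrite ?porbitV rotation_at_vertex inE hk.
  case/porbitP=> i ->; apply/porbitP; exists i; rewrite !permX.
  elim: i {hk} => //= i ->; rewrite permE /r.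
  have -> : dtail (iter i rho h) = dtail h by elim: i => //= i; rewrite permE rtail.
  by case: ifP.
have card_rho : #|porbits rho| = #|vertex G|.
  rewrite -cardsT -(_ : @dtail G @: dart G = setT); last first.
    apply/setP => v; rewrite inE; have [d /eqP <-] := eulerian_dtail eulG v.
    exact: imset_f.
  apply: card_imset_ker => h k; rewrite eq_porbit_mem porbit_sym rhoE.
  exact: eq_sym.
pose face := edge_flip G * rho.
have faceE h : face h = r (dflip h) by rewrite permM edge_flipE permE.
(* Of a state and its reverse, exactly one has the form [c h], and [g] returns this [h]. *)
pose c h : face_state G := (h, o (dtail h)).
pose g (y : face_state G) := if y.2 == o (dtail y.1) then y.1 else dflip y.1.
have porbS h : porbit face (face h) = porbit face h.
  by rewrite -(porbit_perm face 1 h) expg1.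
have c_coh y : y.2 = o (dtail y.1) -> y = c (g y).
  by case: y => d s /= ->; rewrite /g /c /= eqxx.
have c_incoh y : y.2 <> o (dtail y.1) -> face_reverse M y = c (g y).
  case: y => d s /= /eqP ns; rewrite /g /c /= (negbTE ns) dtail_dflip.
  rewrite /face_reverse /= twE; congr pair.
  by move: ns; case: s; case: (o (dtail d)); case: (o (dhead d)).
have coh_step y : (face_step M y).2 = o (dtail (face_step M y).1) <->
    y.2 = o (dtail y.1).
  rewrite face_step_tail /= twE.
  by case: y.2; case: (o (dtail _)); case: (o (dhead _)).
have gc h : g (c h) = h by rewrite /g /c /= eqxx.
have g_reverse y : g (face_reverse M y) = g y.
  case: y => d s; rewrite /g /face_reverse /= twE dtail_dflip dflipK.
  by case: s; case: (o (dtail d)); case: (o (dhead d)).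
have step_c h : face_step M (c h) = c (face h).
  rewrite /c /face_step /= twE addKb faceE rtail /r dtail_dflip.
  by case: (o _).
have g_step y : porbit face (g (face_step M y)) = porbit face (g y).
  case: (y.2 =P o (dtail y.1)) => [/c_coh E|ny]; first by rewrite E step_c !gc porbS.
  have -> : g y = face (g (face_step M y)); last by rewrite porbS.
  rewrite -[face _]gc -step_c -c_incoh; first by rewrite face_step_reverse c_incoh ?gc.
  by move/coh_step.
have faces : size (facial_walks M) = #|porbits face|.
  rewrite size_map -cardE (card_roots (f := porbit face \o g)); first last.
  - move=> x y; apply/idP/idP.
      move=> /connectP[p]; elim: p x => [|z p IHp] x /=; first by move=> _ ->.
      case/andP=> xz zp /(IHp _ zp) /= /eqP <-; case/orP: xz => /eqP ->.
        by rewrite g_step.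
      by rewrite g_reverse.
    have cx z : connect (same_face M) z (c (g z)).
      case: (z.2 =P o (dtail z.1)) => [/c_coh {1}->|/c_incoh <-]; first exact: connect0.
      by apply: connect1; apply/orP; right.
    rewrite /= eq_sym eq_porbit_mem => /porbitP[i yx].
    apply: connect_trans (cx x) _; rewrite (same_face_sym M).
    apply: connect_trans (cx y) _; rewrite (same_face_sym M) yx.
    elim: i {yx} => [|i IHi]; first by rewrite expg0 perm1; exact: connect0.
    apply: connect_trans IHi _; apply: connect1.
    by apply/orP; left; rewrite expgSr permM step_c.
  - exact: same_face_sym.
  rewrite imset_comp; congr #|pred_of_set _|; apply/setP => A.
  apply/imsetP/imsetP => [[h _ ->]|[h _ ->]]; exists h => //.
  by apply/imsetP; exists (c h); rewrite ?gc.
have := odd_permM (edge_flip G) rho; rewrite -/face /odd_perm -faces card_rho.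
have flips := card_fpf_porbits (@edge_flip_fpf G).
have darts : #|dart G| = #|edge G|.*2 by rewrite card_prod card_bool muln2.
have -> : #|porbits (edge_flip G)| = #|edge G|.
  by apply: double_inj; rewrite flips.
rewrite darts odd_double /= !oddD => ->.
by case: odd; case: odd.
Qed.

End Orientable.

(** * Trees of cycles *)

Section Graphs.
Variable G : multigraph.
Implicit Types (d h k : dart G) (w : walk G) (S : {set edge G}) (u v : vertex G).

Lemma edge_set_verticesP S v :
  reflect (exists2 h, h.1 \in S & dtail h = v) (v \in edge_set_vertices S).
Proof.
rewrite inE; apply: (iffP existsP) => [[e /andP[eS /existsP[b /eqP E]]]|[[e b] eS E]].
  by exists (e, b).
by exists e; rewrite eS /=; apply/existsP; exists b; apply/eqP.
Qed.

Lemma adjacent_inP S u v :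
  reflect (exists h, [/\ h.1 \in S, dtail h = u & dhead h = v]) (adjacent_in S u v).
Proof.
apply: (iffP existsP) => [[e /andP[eS /existsP[b /andP[/eqP E1 /eqP E2]]]]|].
  by exists (e, b).
case=> -[e b] [eS E1 E2]; exists e; rewrite eS /=; apply/existsP; exists b.
by rewrite -[ends e b]/(dtail (e, b)) E1 -[ends e _]/(dhead (e, b)) E2 !eqxx.
Qed.

Lemma adjacent_in_sym S : connect_sym (adjacent_in S).
Proof.
apply: sym_connect_sym => u v; apply/adjacent_inP/adjacent_inP => -[h [hS E1 E2]];
  by exists (dflip h); rewrite dtail_dflip dhead_dflip.
Qed.

Lemma connect_edge S h : h.1 \in S -> connect (adjacent_in S) (dtail h) (dhead h).
Proof. by move=> hS; apply/connect1/adjacent_inP; exists h. Qed.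

Lemma eulerian_connected : eulerian G -> connected_graph G.
Proof.
move=> eulG; split; first by case: eulG => -[|d w] [/andP[/andP[]]] //; exists (dtail d).
move=> u v; have [[d /eqP <-] [d' /eqP <-]] := (eulerian_dtail eulG u, eulerian_dtail eulG v).
pose K k := connect (adjacent_in [set: edge G]) (dtail d) (dtail k).
suff E : K d = K d' by rewrite -[connect _ _ _]/(K d') -E /K connect0.
apply: (eulerian_invariant eulG) => [k|k k' kk']; last by rewrite /K kk'.
apply: (same_connect_r (@adjacent_in_sym _)); rewrite dtail_dflip (@adjacent_in_sym _).
by apply: connect_edge; rewrite inE.
Qed.

Lemma next_invariant (T : finType) (s : seq T) (K : pred T) : uniq s ->
    (forall x, x \in s -> K x -> K (next s x)) ->
  forall x y, x \in s -> y \in s -> K x -> K y.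
Proof.
move=> Us Kn x y xs ys Kx; have /connectP[p] := connect_cycle (cycle_next Us) xs ys.
elim: p x xs Kx => [|z p IHp] x xs Kx /=; first by move=> _ ->.
by case/andP=> /eqP <- xp; apply: IHp xp; rewrite ?mem_next // Kn.
Qed.

Lemma is_cycle_rot w n : is_cycle (rot n w) = is_cycle w.
Proof.
rewrite /is_cycle /circuit /closed_walk /walk_edges rot_cycle !map_rot !rot_uniq.
by rewrite -!size_eq0 size_rot.
Qed.

Lemma is_cycle_dhead_inj w : is_cycle w -> {in w &, injective (@dhead G)}.
Proof.
case/andP=> cw Ut d d' dw d'w; have /andP[clw _] := cw.
rewrite !(closed_walk_next clw) // => E.
apply: (can_inj (prev_next (circuit_uniq cw))).
by apply: (uniq_map_inj_in Ut); rewrite ?mem_next.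
Qed.

Lemma is_cycle_rev w : is_cycle w -> is_cycle (rev_walk w).
Proof.
move=> cyw; have /andP[/andP[/andP[w0 cw] Uw] Ut] := cyw.
have Eh : [seq dtail d | d <- rev_walk w] = rev [seq dhead d | d <- w].
  by rewrite /rev_walk map_rev -map_comp.
rewrite /is_cycle /circuit /closed_walk Eh rev_uniq.
have -> : walk_edges (rev_walk w) = rev (walk_edges w).
  by rewrite /walk_edges /rev_walk map_rev -map_comp.
rewrite rev_uniq Uw -size_eq0 size_rev size_map size_eq0 w0 /= andbT.
apply/andP; split.
  rewrite rev_cycle cycle_map; apply: sub_cycle cw => d d' /= /eqP E.
  by rewrite dhead_dflip -E dtail_dflip.
by rewrite map_inj_in_uniq ?(circuit_uniq (proj1 (andP cyw))) //; exact: is_cycle_dhead_inj.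
Qed.

Lemma is_cycle_same w w' : same_walk w w' -> is_cycle w' -> is_cycle w.
Proof.
by move=> /same_walkP[n [->|->]] cw; rewrite is_cycle_rot //; exact: is_cycle_rev.
Qed.

Lemma subcycle_rot c w d : is_cycle c -> circuit w ->
    {subset walk_edges w <= walk_edges c} -> d \in w -> d \in c ->
  exists n, w = rot n c.
Proof.
move=> cyc cw sub dw dc; have /andP[cc Ut] := cyc.
have [Uw Uc] := (circuit_uniq cw, circuit_uniq cc).
have [/andP[clw Uew] /andP[clc _]] := (cw, cc).
(* The dart [next w x] either belongs to [c], and its tail then determines it, or is the reverse of
   the dart of [c] with head [dhead x]. The latter is [x] itself, but a circuit uses no edge
   twice. *)
have nextE x : x \in w -> x \in c -> next w x = next c x.
  move=> xw xc; have nw : next w x \in w by rewrite mem_next.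
  have : (next w x).1 \in walk_edges c by apply/sub/map_f.
  rewrite mem_walk_edges => /orP[nc|fnc].
    apply: (uniq_map_inj_in Ut); rewrite ?mem_next //.
    by rewrite -(closed_walk_next clw) // (closed_walk_next clc).
  have xE : dflip (next w x) = x.
    apply: (is_cycle_dhead_inj cyc) => //.
    by rewrite dhead_dflip (closed_walk_next clw).
  have E : next w x = x by apply: (uniq_map_inj_in Uew) => //; rewrite -[in RHS]xE.
  by have := dflip_neq x; rewrite -{1}E xE eqxx.
have wc x : x \in w -> x \in c.
  move=> xw; apply: (next_invariant (K := mem c) Uw) dw xw dc => y yw yc.
  by rewrite [mem c _]/= nextE ?mem_next.
have cyw : fcycle (next c) w.
  apply: (sub_in_cycle (P := mem w)) (cycle_next Uw) => [x y xw _ /eqP <-|].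
    by rewrite /= nextE ?wc.
  exact/allP.
have [i Ei] := orbit_rot_cycle cyw Uw dw.
have [j Ej] := orbit_rot_cycle (cycle_next Uc) Uc dc.
have [k ->] := rot_sym_ex Ei; rewrite Ej; exact: rot_rot_ex.
Qed.

Lemma subcycle_same c w : is_cycle c -> circuit w ->
  {subset walk_edges w <= walk_edges c} -> same_walk w c.
Proof.
move=> cyc cw sub; have /andP[/andP[w0 _] _] := cw.
case: w w0 cw sub => // d w _ cw sub.
have : d.1 \in walk_edges c by apply: sub; rewrite inE eqxx.
rewrite mem_walk_edges => /orP[dc|dc].
  have [n ->] := subcycle_rot cyc cw sub (mem_head _ _) dc.
  by apply/same_walkP; exists n; left.
have dc' : d \in rev_walk c by rewrite mem_rev -(dflipK d) map_f.
have sub' : {subset walk_edges (d :: w) <= walk_edges (rev_walk c)}.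
  by move=> e /sub; rewrite {2}/walk_edges /rev_walk map_rev mem_rev -map_comp.
have [n ->] := subcycle_rot (is_cycle_rev cyc) cw sub' (mem_head _ _) dc'.
by apply/same_walkP; exists n; right.
Qed.

(** The cycle passes from [S1] to [S2] and back at two different vertices, and both are common to
    the two parts. *)
Lemma cycle_nonseparable w : is_cycle w ->
  nonseparable [set e | e \in walk_edges w].
Proof.
case/andP=> cw Ut; have Uw := circuit_uniq cw.
have /andP[clw _] := cw; have /andP[w0 cyw] := clw.
set S := [set e | _]; have inS d : d \in w -> d.1 \in S.
  by move=> dw; rewrite inE map_f.
have vS v : v \in edge_set_vertices S -> v \in [seq dtail d | d <- w].
  case/edge_set_verticesP=> h; rewrite inE mem_walk_edges => /orP[] hw <-.
    exact: map_f.
  by rewrite -(dflipK h) dtail_dflip (closed_walk_next clw hw) map_f // mem_next.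
split.
- by case: w w0 @S inS {cw Ut Uw clw cyw vS} => // d w _ S inS;
    apply/set0Pn; exists d.1; apply/inS/mem_head.
- move=> u v /vS uw /vS; apply: connect_cycle uw; rewrite cycle_map.
  apply: (sub_in_cycle (P := mem w)) cyw => [x y xw _ /eqP E|]; last exact/allP.
  by apply/adjacent_inP; exists x; rewrite inS.
move=> S1 S2 [S12 dis /andP[/set0Pn[e1 e1S] /set0Pn[e2 e2S]] _ card1].
have edge_dart e : e \in S -> exists2 d, d \in w & d.1 = e.
  by rewrite inE => /mapP[d dw ->]; exists d.
have inS2 d : d \in w -> (d.1 \in S2) = (d.1 \notin S1).
  move=> /inS; rewrite -S12 inE; case: (boolP (d.1 \in S1)) => //= d1 _.
  by apply/negbTE; apply: contraL d1 => d2; rewrite (disjointFl dis).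
have [|d1 d1w d1E] := edge_dart e1; first by rewrite -S12 inE e1S.
have [|d2 d2w d2E] := edge_dart e2; first by rewrite -S12 inE e2S orbT.
have leave (K : pred (dart G)) x y : x \in w -> y \in w -> K x -> ~~ K y ->
    exists2 a, a \in w & K a && ~~ K (next w a).
  move=> xw yw Kx nKy; have [/hasP//|/hasPn H] := boolP (has (fun a => K a && ~~ K (next w a)) w).
  case/negP: nKy; apply: next_invariant Uw _ _ _ xw yw Kx => a aw Ka.
  by have := H a aw; rewrite Ka negbK.
have [a aw /andP[a1 a2]] : exists2 a, a \in w & (a.1 \in S1) && ((next w a).1 \notin S1).
  by apply: (leave (fun d => d.1 \in S1) d1 d2); rewrite // ?d1E // -inS2 // d2E.
have [b bw /andP[b1 b2]] : exists2 b, b \in w & (b.1 \notin S1) && ~~ ((next w b).1 \notin S1).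
  by apply: (leave (fun d => d.1 \notin S1) d2 d1); rewrite // ?d1E ?negbK // -inS2 // d2E.
have [naw nbw] : next w a \in w /\ next w b \in w by rewrite !mem_next.
rewrite negbK in b2; rewrite -!inS2 // in a2 b1.
have both x : x \in w -> x.1 \in S1 /\ (next w x).1 \in S2 \/
      x.1 \in S2 /\ (next w x).1 \in S1 ->
    dtail (next w x) \in edge_set_vertices S1 :&: edge_set_vertices S2.
  move=> xw H; rewrite inE -(closed_walk_next clw xw); apply/andP.
  by case: H => -[H1 H2]; split; apply/edge_set_verticesP;
    (exists (dflip x) => //; exact: dtail_dflip) ||
    (exists (next w x) => //; rewrite (closed_walk_next clw xw)).
have sub : [set dtail (next w a); dtail (next w b)] \subset
    edge_set_vertices S1 :&: edge_set_vertices S2.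
  by apply/subsetP => v; rewrite inE => /orP[]/set1P ->; apply: both; auto.
have := subset_leq_card sub; rewrite card1 cards2.
case: eqP => // /(uniq_map_inj_in Ut naw nbw) E.
by move: a2; rewrite E inS2 // b2.
Qed.

(** Adjacency does not name edges; because the vertices are distinct, the edges chosen for the steps
    are distinct too. *)
Lemma path_darts S u p : path (adjacent_in S) u p -> uniq (u :: p) ->
  exists ds : walk G, [/\ [seq dhead d | d <- ds] = p, [seq dtail d | d <- ds] = belast u p,
    {in ds, forall d, d.1 \in S}, uniq (walk_edges ds)
    & forall d0, dhead d0 = u -> path [rel d1 d2 | dhead d1 == dtail d2] d0 ds].
Proof.
elim: p u => [|v p IHp] u /=; first by exists [::].
case/andP=> /adjacent_inP[d [dS dt dh]] vp /andP[unp Uvp].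
have [ds [Eh Et inS Ue cp]] := IHp v vp Uvp.
exists (d :: ds); rewrite /= Eh Et dt dh; split=> //.
- by move=> x; rewrite inE => /predU1P[->|/inS].
- rewrite Ue andbT mem_walk_edges; apply: contra unp => /orP[] dds.
    by apply: mem_belast; rewrite -Et -dt map_f.
  rewrite inE; apply/orP; right.
  by rewrite -Eh -dt -dhead_dflip map_f.
by move=> d0 E; rewrite E eqxx cp.
Qed.

(** A simple path in [S] from the head of [d] to its tail is closed up by [d]; for a loop this path
    is empty. *)
Lemma cycle_through S d : d.1 \notin S ->
    connect (adjacent_in S) (dhead d) (dtail d) ->
  exists2 w, is_cycle w & d \in w /\ {in w, forall x, x = d \/ x.1 \in S}.
Proof.
move=> dS /connectP[p0 /shortenP[p pp Up _] E].
have [ds [Eh Et inS Ue cp]] := path_darts pp Up.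
exists (d :: ds); last first.
  split; first exact: mem_head.
  by move=> x; rewrite inE => /predU1P[->|/inS]; [left|right].
rewrite /is_cycle /circuit /closed_walk /= rcons_path cp //= Et Ue andbT.
have -> : dhead (last d ds) == dtail d by rewrite E -Eh last_map.
have -> /= : d.1 \notin walk_edges ds.
  by apply: contra dS => /mapP[x xds ->]; exact: inS.
by move: Up; rewrite lastI rcons_uniq E.
Qed.

End Graphs.

(** * Incidence trees and trees of cycles *)

Section IncidenceTree.
Variables (G : multigraph) (C : seq (walk G)) (P : {perm dart G}).
Hypotheses (eulG : eulerian G) (decC : circuit_decomposition C).
Hypothesis innerP : inner_pairing C P.
Implicit Types (d h k : dart G) (w : walk G) (S : {set edge G}).

Local Notation cidx := (circuit_index decC).

Let PK : involutive P. Proof. by case: innerP => Pi _ _ h; case: (Pi h). Qed.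
Let Ptail h : dtail (P h) = dtail h. Proof. by case: innerP. Qed.

Section Tree.
Hypothesis tree : incidence_tree P decC.

(** Two passes of a circuit through one vertex would be parallel edges of the incidence graph, hence
    no bridges. *)
Lemma incidence_tree_cycle w : w \in C -> is_cycle w.
Proof.
move=> wC; have cw := decomposition_circuit decC wC; rewrite /is_cycle cw /=.
rewrite map_inj_in_uniq ?(circuit_uniq cw) // => d d' dw d'w E.
have /pass_bridgeP[p [g H]] := tree d.
have := H d'; rewrite -E (mem_circuit_index decC wC d'w dw) H eqxx /=.
case: eqP => [-> //|_ /esym /= /eqP d'P].
have := mem_forward decC wC d'w; rewrite d'P (forward_inner decC innerP).
by rewrite (mem_forward decC wC dw).
Qed.

(** If edges of [S] from different circuits meet at [v], the cut of a pass at [v] divides the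
    circuits into two classes. Away from [v] it divides the vertices accordingly, so the two parts
    of [S] share only [v] and form a separation. *)
Lemma nonseparable_circuit S : nonseparable S ->
  forall e e', e \in S -> e' \in S -> cidx e = cidx e'.
Proof.
case=> _ conS nsep e e' eS e'S.
have [|] := boolP [exists h, exists h', [&& h.1 \in S, h'.1 \in S,
    dtail h == dtail h' & cidx h.1 != cidx h'.1]]; last first.
  rewrite negb_exists => /forallP none.
  have {}none h h' : h.1 \in S -> h'.1 \in S -> dtail h = dtail h' -> cidx h.1 = cidx h'.1.
    move=> hS h'S E; have := none h; rewrite negb_exists => /forallP/(_ h').
    by rewrite hS h'S E eqxx /= negbK => /eqP.
  suff H h h' : h.1 \in S -> h'.1 \in S -> connect (adjacent_in S) (dtail h) (dtail h') ->
      cidx h.1 = cidx h'.1.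
    apply: (H (e, true) (e', true)) => //.
    by apply: conS; apply/edge_set_verticesP; [exists (e, true)|exists (e', true)].
  move=> hS h'S /connectP[p]; elim: p h hS => [|z p IHp] h hS /=.
    by move=> _ E; apply: none.
  case/andP=> /adjacent_inP[k [kS kt kh]] zp E.
  rewrite (none _ _ hS kS) ?kt // -[k.1]/((dflip k).1).
  by apply: IHp; rewrite // dtail_dflip kh.
case/existsP=> h /existsP[h' /and4P[hS h'S /eqP hh' ch]].
have /pass_bridgeP[p [g H]] := tree h; set v := dtail h.
have other k : dtail k <> v -> g (cidx k.1) = p (dtail k).
  move=> kv; have := H k; case: eqP => [E|_]; first by case: kv; rewrite E.
  case: eqP => [E|_]; first by case: kv; rewrite E Ptail.
  by case: (p _); case: (g _).
have gh : g (cidx h.1) = ~~ p v by have := H h; rewrite eqxx -/v; case: (p v); case: (g _).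
have gh' : g (cidx h'.1) = p v.
  have := H h'; rewrite -hh' -/v; case: eqP => [E|_]; first by rewrite E eqxx in ch.
  case: eqP => [E|_]; first by rewrite E (circuit_index_inner decC innerP) eqxx in ch.
  by case: (p v); case: (g _).
pose part b := [set x in S | g (cidx x) == b].
(* A path of [S] leading to [v] stays in its part until it reaches [v], since all edges of [S] at
   any other vertex are in the same part. *)
have conpart b : v \in edge_set_vertices (part b) -> connected_edge_set (part b).
  move=> vb; suff H1 u : u \in edge_set_vertices (part b) -> connect (adjacent_in (part b)) u v.
    move=> u1 u2 /H1 c1 /H1 c2; apply: connect_trans c1 _.
    by rewrite (@adjacent_in_sym _ _).
  move=> ub; have uS : u \in edge_set_vertices S.
    case/edge_set_verticesP: ub => k; rewrite inE => /andP[kS _] kt.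
    by apply/edge_set_verticesP; exists k.
  have vS : v \in edge_set_vertices S by apply/edge_set_verticesP; exists h.
  have /connectP[q] := conS u v uS vS.
  elim: q u ub {uS} => [|z q IHq] u ub /=; first by move=> _ ->; exact: connect0.
  case/andP=> /adjacent_inP[k [kS kt kh]] zq E.
  case: (u =P v) => [->|uv]; first exact: connect0.
  have kb : k.1 \in part b.
    rewrite inE kS other ?kt //; case/edge_set_verticesP: ub => k'.
    by rewrite inE => /andP[_ /eqP <-] k'u; rewrite -k'u in uv *; rewrite other ?eqxx.
  have adj : adjacent_in (part b) u z by apply/adjacent_inP; exists k.
  apply: connect_trans (connect1 adj) _; apply: IHq => //.
  by apply/edge_set_verticesP; exists (dflip k); rewrite // dtail_dflip.
have vpart b : v \in edge_set_vertices (part b).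
  apply/edge_set_verticesP; case: (g (cidx h.1) =P b) => E.
    by exists h; rewrite // inE hS E eqxx.
  by exists h'; rewrite // inE h'S gh'; move: E; rewrite gh; case: (p v); case: b.
case: (nsep (part true) (part false)); split.
- by apply/setP => x; rewrite !inE -andb_orr; case: (g _); rewrite andbT.
- rewrite -setI_eq0; apply/eqP/setP => x; rewrite !inE.
  by case: (g _); rewrite ?andbF.
- by apply/andP; split; apply/set0Pn;
    [have /edge_set_verticesP[k kb _] := vpart true|have /edge_set_verticesP[k kb _] := vpart false];
    exists k.1.
- by split; apply: conpart.
have -> : edge_set_vertices (part true) :&: edge_set_vertices (part false) = [set v];
  last by rewrite cards1.
apply/setP => u; rewrite !in_setI in_set1; apply/andP/eqP => [[ut uf]|->]; last by rewrite !vpart.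
apply/eqP; apply: contraT => /eqP uv.
have gu b : u \in edge_set_vertices (part b) -> p u = b.
  case/edge_set_verticesP=> k; rewrite inE => /andP[_ /eqP <-] ku.
  by rewrite -ku other // ku.
by have := gu _ ut; rewrite (gu _ uf).
Qed.

(** A cycle is nonseparable, so its edges come from one circuit of [C]; that circuit is a cycle and
    contains no other circuit. *)
Lemma incidence_tree_cycles : collection_of_all_cycles C.
Proof.
move=> w; split=> [cw|[w' /incidence_tree_cycle cw' ww']]; last exact: is_cycle_same ww' cw'.
have nsw := nonseparable_circuit (cycle_nonseparable cw).
have /andP[ciw _] := cw; have /andP[/andP[w0 _] _] := ciw.
have [d dw] : exists d, d \in w by case: w w0 {cw nsw ciw} => // d w _; exists d; exact: mem_head.
have dE : d.1 \in walk_edges w by exact: map_f.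
exists (circuit_of decC d.1); first exact: circuit_of_mem.
apply: subcycle_same ciw _ => [|e ew]; first exact/incidence_tree_cycle/circuit_of_mem.
rewrite /circuit_of (nsw d.1 e) ?inE //; exact: circuit_ofP.
Qed.

(** A block lies in a single circuit, which is itself nonseparable; maximality makes them equal. *)
Lemma incidence_tree_of_cycles : tree_of_cycles G.
Proof.
split; first exact: eulerian_connected.
move=> S [nsS maxS]; have [/set0Pn[e eS] _ _] := nsS.
have cyc : is_cycle (circuit_of decC e) by exact/incidence_tree_cycle/circuit_of_mem.
exists (circuit_of decC e) => //; apply/esym/maxS; last exact: cycle_nonseparable.
apply/subsetP => e' e'S; rewrite inE /circuit_of.
by rewrite (nonseparable_circuit nsS eS e'S); exact: circuit_ofP.
Qed.

End Tree.

(* In the graph without the edges of [d] and of its predecessor [d1] on their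
   circuit [c], no vertex of [c] other than [dtail d] is reachable from [dtail d]:
   otherwise some cycle would contain [d] but not [d1]. *)
Lemma all_cycles_incidence_tree : collection_of_all_cycles C -> incidence_tree P decC.
Proof.
move=> allC; have cycC w : w \in C -> is_cycle w.
  by move=> wC; apply/allC; exists w => //; exact: same_walk_refl.
suff fw d : forward decC d -> pass_bridge P decC d.
  move=> h; case: (boolP (forward decC h)) => [/fw //|nf].
  have /fw/pass_bridgeP[p [g H]] : forward decC (P h) by rewrite (forward_inner decC innerP).
  by apply/pass_bridgeP; exists p, g => k; rewrite H PK orbC.
move=> dc; set c := circuit_of decC d.1 in dc; have cC : c \in C by exact: circuit_of_mem.
have cyc := cycC c cC; have /andP[cir _] := cyc; have /andP[clc Uec] := cir.
have Uc := circuit_uniq cir.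
pose d1 := prev c d; have d1c : d1 \in c by rewrite mem_prev.
have nd1 : next c d1 = d by rewrite next_prev.
pose S := [set e | (e != d.1) && (e != d1.1)].
pose p v := connect (adjacent_in S) (dtail d) v.
have pS h : h.1 \in S -> p (dhead h) = p (dtail h).
  by move=> /connect_edge hS; apply/esym/(same_connect_r (@adjacent_in_sym _ _)).
have inS w x : w \in C -> x \in w -> w != c -> x.1 \in S.
  move=> wC xw; rewrite inE -negb_or; apply: contra => xd; apply/eqP.
  rewrite -(mem_circuit_of decC wC xw); apply/esym/(circuit_of_unique decC cC).
  by case/orP: xd => /eqP ->; rewrite map_f.
(* The case [d = d1] is left out: the circuit is then a loop, whose head is its tail and so
   reachable. *)
have hd_edge : d != d1 -> ~~ p (dhead d).
  move=> dd1; apply/negP => pd; have dS : d.1 \notin S by rewrite inE eqxx.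
  rewrite /p adjacent_in_sym in pd; have [w cw [dw wS]] := cycle_through dS pd.
  have /allC[w' w'C ww'] := cw.
  have w'E : w' = c.
    rewrite (circuit_of_unique decC (e := d.1) w'C) //.
    by rewrite -(same_walk_mem ww') map_f.
  have : d1.1 \in walk_edges w by rewrite (same_walk_mem ww') w'E map_f.
  case/mapP=> x xw E; case: (wS x xw) => [xd|]; last by rewrite inE -E eqxx andbF.
  by case/eqP: dd1; apply: (uniq_map_inj_in Uec) => //; rewrite E xd.
have on_c x : x \in c -> (x == d) || ~~ p (dtail x).
  move=> xc; pose K y := (y == d) || ~~ p (dtail y).
  apply: (next_invariant (K := K) Uc _ dc xc); last by rewrite /K eqxx.
  move=> y yc; rewrite /K; case: (next c y =P d) => //= /eqP ny.
  rewrite -(closed_walk_next clc yc); case: (y =P d) => [yd _|/eqP yd /= py].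
    rewrite yd in ny *.
    by apply: hd_edge; apply: contra ny => /eqP E; rewrite -[X in _ == X]nd1 -E.
  rewrite pS // inE; apply/andP; split.
    by apply: contra yd => /eqP E; apply/eqP; apply: (uniq_map_inj_in Uec).
  apply: contra ny => /eqP E; apply/eqP; rewrite -nd1; congr (next c _).
  exact: (uniq_map_inj_in Uec).
(* [g] is false on [c] and elsewhere the common value of [p] along the circuit; circuits are
   nonempty, so the default of [head] never occurs. *)
pose g (i : 'I_(size C)) :=
  (i != cidx d.1) && p (dtail (head d (nth [::] C i))).
apply/pass_bridgeP; exists p, g.
suff fwd k : forward decC k -> p (dtail k) (+) g (cidx k.1) = ((k == d) || (k == P d)).
  move=> k; case: (boolP (forward decC k)) => [/fwd //|nf].
  rewrite -Ptail -(circuit_index_inner decC innerP) fwd; last by rewrite (forward_inner decC innerP).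
  by rewrite (inj_eq perm_inj) -[k in RHS]PK (inj_eq perm_inj) PK orbC.
move=> kf; have -> : k == P d = false.
  by apply/negbTE; apply: contraTneq kf => ->; rewrite (forward_inner decC innerP) negbK.
rewrite orbF /g; case: (cidx k.1 =P cidx d.1) => E.
  have kc : k \in c by move: kf; rewrite /forward /circuit_of E.
  rewrite addbF; case: (k =P d) (on_c k kc) => [-> _|_ /negbTE -> //].
  exact: connect0.
have kd : k == d = false by apply/negbTE; apply: contra_notN E => /eqP ->.
rewrite kd /= -[nth _ _ _]/(circuit_of decC k.1); set w := circuit_of decC k.1.
have kw : k \in w by [].
have wC : w \in C by exact: circuit_of_mem.
have wc : w != c.
  apply/negP => /eqP wE; case: E; apply: (mem_circuit_index decC wC) => //.
  by rewrite wE.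
have cw := decomposition_circuit decC wC; have /andP[clw _] := cw.
suff -> : p (dtail (head d w)) = p (dtail k) by rewrite addbb.
have hw : head d w \in w by case: (w) kw => // x s _; exact: mem_head.
apply/eqP; apply: (next_invariant (K := fun x => p (dtail x) == p (dtail k))
  (circuit_uniq cw) _ kw hw); last exact: eqxx.
move=> x xw /eqP <-; rewrite -(closed_walk_next clw xw) pS //.
exact: inS xw wc.
Qed.

End IncidenceTree.

(* Euler genus and the proof of the theorem *)
Local Close Scope group_scope.

Lemma euler_genusE (G : multigraph) (M : embedding G) : eulerian G ->
  euler_genus M = (2 - euler_characteristic M)%R.
Proof.
move=> eulG; rewrite /euler_genus /genus; case: (boolP (orientable M)) => // orM.
have := even_halfK (orientable_even eulG orM).
(* [k] is half the number of vertices, edges and faces together, so the characteristic is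
   [2 * (k - #|edge G|)]. *)
set k := _./2; rewrite /euler_characteristic -muln2 => E.
have -> : (2 - (#|vertex G|%:Z - #|edge G|%:Z + (size (facial_walks M))%:Z) =
           (1 - k%:Z + #|edge G|%:Z) * 2)%R by lia.
by rewrite mulzK // GRing.mulrC.
Qed.

Theorem theorem6p5 (G : multigraph) (C : seq (walk G))
    (G_nontrivial : nontrivial G) (G_eulerian : eulerian G)
    (C_decomposition : circuit_decomposition C) :
  [/\ (tree_of_cycles G /\ collection_of_all_cycles C ->
        (forall (M : embedding G) (W' : seq (walk G)),
            relative_embedding M C W' -> planar M /\ size W' = 1) /\
        (exists (M : embedding G) (W' : seq (walk G)),
            relative_embedding M C W')),
      (~ (tree_of_cycles G /\ collection_of_all_cycles C) ->
        [/\ exists (M : embedding G) (W' : seq (walk G)),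
              relative_embedding M C W' /\ orientable M,
            exists (M : embedding G) (W' : seq (walk G)),
              relative_embedding M C W' /\ ~~ orientable M
          & exists (M : embedding G) (w' : walk G),
              relative_embedding M C [:: w'] /\ ~~ orientable M])
    & forall (M : embedding G) (w' : walk G),
        relative_embedding M C [:: w'] ->
        [/\ euler_circuit w',
            forall (M' : embedding G) (W' : seq (walk G)),
              relative_embedding M' C W' ->
              (euler_genus M' <= euler_genus M)%R
          & forall (M' : embedding G) (W' : seq (walk G)),
              relative_embedding M' C W' -> orientable M' = orientable M ->
              (genus M' <= genus M)%R]].
Proof.
have [P innerP] := exists_inner_pairing C_decomposition.
have [Q0 outQ0 colQ0] := exists_bicolorable_outer G_eulerian C_decomposition innerP.
have [M0 [eps0 frame0]] := outer_pairing_framed G_eulerian innerP outQ0.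
have Q0i : fpf_involution Q0 by case: outQ0.
have rel0 := framed_relative G_eulerian C_decomposition innerP Q0i frame0.
split.
- case=> _ allC; have tree := all_cycles_incidence_tree C_decomposition innerP allC.
  split; last by exists M0; eexists; exact: rel0.
  move=> M W' rel; have W1 := incidence_tree_one_face G_eulerian innerP G_nontrivial tree rel.
  have orM := incidence_tree_orientable G_eulerian innerP tree rel.
  split=> //; split=> //; rewrite /genus orM /euler_characteristic.
  rewrite (relative_size rel) W1.
  (* With one outer face, the node count of the tree makes the characteristic equal to 2. *)
  have := incidence_tree_card G_eulerian innerP tree; lia.
- move=> notree; have [h nbr] : exists h, ~~ pass_bridge P C_decomposition h.
    apply/existsP; rewrite -negb_forall; apply/negP => /forallP tree; case: notree.
    split; first exact: incidence_tree_of_cycles innerP tree.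
    exact: incidence_tree_cycles innerP tree.
  have [Q1 outQ1 conn1] := exists_connected_outer G_eulerian innerP outQ0.
  have [M1 [eps1 frame1]] := outer_pairing_framed G_eulerian innerP outQ1.
  have Q1i : fpf_involution Q1 by case: outQ1.
  have [M [w [rel nor]]] : exists M w, relative_embedding M C [:: w] /\ ~~ orientable M.
    case: (boolP (orientable M1)) => [or1|nor1].
      have col1 := proj1 (framed_orientable G_eulerian innerP Q1i frame1) or1.
      have [R [outR connR ncolR]] := twist_outer G_eulerian innerP outQ1 conn1 nbr col1.
      have [M [eps frame]] := outer_pairing_framed G_eulerian innerP outR.
      have Ri : fpf_involution R by case: outR.
      have [w rel] := framed_one_face G_eulerian C_decomposition innerP Ri frame connR.
      exists M, w; split=> //; apply/negP => orM; apply: ncolR.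
      exact: (proj1 (framed_orientable G_eulerian innerP Ri frame) orM).
    have [w rel] := framed_one_face G_eulerian C_decomposition innerP Q1i frame1 conn1.
    by exists M1, w.
  split; [|by exists M, [:: w]|by exists M, w].
  exists M0; eexists; split; first exact: rel0.
  exact: (proj2 (framed_orientable G_eulerian innerP Q0i frame0) colQ0).
(* Among embeddings relative to [C], the characteristic varies only with the number of outer
   faces. *)
move=> M w rel; have chi M' W' : relative_embedding M' C W' ->
    (euler_characteristic M <= euler_characteristic M')%R.
  move=> rel'; rewrite /euler_characteristic (relative_size rel) (relative_size rel') /=.
  have := relative_gt0 C_decomposition G_nontrivial rel'; lia.
split=> [|M' W' /chi|M' W' /chi + orE].
- exact: (relative_euler_circuit G_eulerian C_decomposition rel).
- by rewrite !euler_genusE //; lia.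
by rewrite /genus orE; case: ifP => _; lia.
Qed.
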